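(* Let $(\mathcal A,\mathbb E)$ be a $B$-valued probability space and $a,b\in\mathcal A$ free with $\mathbb E(a),\mathbb E(b)\in B^\times$. Then $$S_{ab}=S_b\cdot\big(S_a\circ(S_b^{-1}\cdot I\cdot S_b)\big).$$
   Context: $B$ is a unital algebra over a field $\mathbb K$ of characteristic zero. $\mathrm{Mult}[[B]]$: sequences $f=(f_n)_{n\ge0}$ of multilinear maps $f_n:B^n\to B$. Product $(f\cdot g)_n(x_1,\dots,x_n)=\sum_{k=0}^n f_k(x_1,\dots,x_k)g_{n-k}(x_{k+1},\dots,x_n)$; for $g_0=0$, composition $(f\circ g)_n(x_1,\dots,x_n)=\sum_{l\ge0}\sum_{k_1+\dots+k_l=n,k_i\ge1}f_l(g_{k_1}(x_1,\dots,x_{k_1}),\dots,g_{k_l}(x_{n-k_l+1},\dots,x_n))$; $I=(\delta_{n,1}\mathrm{id}_B)$; composition binds tighter than product; $S^{-1}$ is the multiplicative inverse. $G_B^{\mathrm{inv}}=\{f:f_0\in B^\times\}$, $G_B^I=\{I\cdot F:F\in G_B^{\mathrm{inv}}\}$ with $(I\cdot F)_n(x_1,\dots,x_n)=x_1F_{n-1}(x_2,\dots,x_n)$. For $f\in G_B^I$, $f$ has a compositional inverse in $G_B^I$ and its S-transform $S_f\in G_B^{\mathrm{inv}}$ is defined by $f^{\circ-1}=I\cdot S_f$. $B$-valued probability space $(\mathcal A,\mathbb E)$: $\mathcal A$ a unital $\mathbb K$-algebra and $B$-bimodule with all mixed triple products associative, $\mathbb E:\mathcal A\to B$ linear, unital,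 $\mathbb E(xay)=x\mathbb E(a)y$ ($x,y\in B$). Freeness of $a,b$: for the $B$-subalgebras $\mathcal A_1,\mathcal A_2$ they generate, $\mathbb E(a_1\cdots a_n)=0$ whenever $n\ge1$, each $\mathbb E(a_i)=0$, $a_i\in\mathcal A_{j_i}$, $j_i\neq j_{i+1}$. Cumulants: with planar binary trees $Y_n$ ($Y_0=\{|\}$, $Y_n=\{\sigma\vee\tau:|\sigma|+|\tau|=n-1\}$), each $\tau\in Y_n$ ($n\ge1$) uniquely $\tau=\tau_1\vee(\tau_2\vee(\cdots\vee(\tau_k\vee|)))$, $j_i=|\tau_1|+\dots+|\tau_i|+i$, multilinear $\kappa_n:\mathcal A^n\to B$ are defined by $\mathbb E(a_1\cdots a_n)=\sum_{\tau\in Y_n}\kappa_\tau(a_1,\dots,a_n)$, $\kappa_|=1$, $\kappa_\tau(a_1,\dots,a_n)=\kappa_k(\kappa_{\tau_1}(a_1,\dots,a_{j_1-1})a_{j_1},\dots,\kappa_{\tau_k}(a_{j_{k-1}+1},\dots,a_{j_k-1})a_{j_k})$. For $a\in\mathcal A$: $k^a_0=0$, $k^a_n(x_1,\dots,x_n)=\kappa_n(x_1a,\dots,x_na)$; when $\mathbb E(a)\in B^\times$, $k^a\in G_B^I$ and $S_a:=S_{k^a}$. *)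

(* Defs.v *)
From HB Require Import structures.
From mathcomp Require Import all_boot all_order all_algebra.
From Stdlib Require Import ClassicalEpsilon.
Set Implicit Arguments. Unset Strict Implicit. Unset Printing Implicit Defensive.
Import Order.TTheory GRing.Theory.
Local Open Scope ring_scope.

(* K : fieldType of characteristic 0, B : algType K (unital,
   possibly noncommutative K-algebra).  An element f of Mult[[B]] is modelled as
   a function  f : seq B -> B, its n-th component f_n being its restriction to
   lists of size n; membership in Mult[[B]] is the predicate [multilinear]. *)

Section Mult.
Variables (K : fieldType) (B : algType K).

Definition unitB (x : B) : Prop := exists y : B, x * y = 1 /\ y * x = 1.

Definition multilinear (f : seq B -> B) : Prop :=
  forall (s1 s2 : seq B) (k : K) (x y : B),
    f (s1 ++ (k *: x + y) :: s2) = k *: f (s1 ++ x :: s2) + f (s1 ++ y :: s2).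

Definition mmul (f g : seq B -> B) : seq B -> B :=
  fun xs => \sum_(0 <= k < (size xs).+1) f (take k xs) * g (drop k xs).

Definition mone : seq B -> B := fun xs => if xs is [::] then 1 else 0.

Definition mI : seq B -> B := fun xs => if xs is [:: x] then x else 0.

End Mult.

(* all decompositions of a list into consecutive nonempty blocks *)
Fixpoint splits (T : Type) (s : seq T) : seq (seq (seq T)) :=
  match s with
  | [::] => [:: [::]]
  | x :: s' =>
      if s' is [::] then [:: [:: [:: x]]]
      else flatten [seq [:: [:: x] :: d ; (x :: head [::] d) :: behead d]
                   | d <- splits s']
  end.

Section Mult2.
Variables (K : fieldType) (B : algType K).

Definition mcomp (f g : seq B -> B) : seq B -> B :=
  fun xs => \sum_(d <- splits xs) f (map g d).

Definition G_inv (f : seq B -> B) : Prop := multilinear f /\ unitB (f [::]).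

Definition G_I (f : seq B -> B) : Prop :=
  exists F, G_inv F /\ f = mmul (@mI K B) F.

Definition minv (f : seq B -> B) : seq B -> B :=
  epsilon (inhabits (fun _ => 0))
    (fun g => multilinear g /\ mmul f g = @mone K B /\ mmul g f = @mone K B).

Definition compinv (f : seq B -> B) : seq B -> B :=
  epsilon (inhabits (fun _ => 0))
    (fun h => G_I h /\ mcomp h f = @mI K B /\ mcomp f h = @mI K B).

Definition Stransform (f : seq B -> B) : seq B -> B :=
  epsilon (inhabits (fun _ => 0))
    (fun S => G_inv S /\ compinv f = mmul (@mI K B) S).

End Mult2.

Section Prob.
Variables (K : fieldType) (B : algType K) (A : algType K).
Variables (lB : B -> A -> A) (rB : A -> B -> A) (E : A -> B).

Definition bprob_space : Prop :=
  (forall x y c, lB (x + y) c = lB x c + lB y c) /\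
      (forall x c d, lB x (c + d) = lB x c + lB x d) /\
      (forall (k : K) x c, lB (k *: x) c = k *: lB x c /\ lB x (k *: c) = k *: lB x c) /\
      (forall x y c, rB c (x + y) = rB c x + rB c y) /\
      (forall x c d, rB (c + d) x = rB c x + rB d x) /\
      (forall (k : K) x c, rB c (k *: x) = k *: rB c x /\ rB (k *: c) x = k *: rB c x) /\
      (forall c, lB 1 c = c /\ rB c 1 = c) /\
      (forall x y c, lB (x * y) c = lB x (lB y c) /\ rB c (x * y) = rB (rB c x) y
                     /\ rB (lB x c) y = lB x (rB c y)) /\
      (forall x c d, lB x (c * d) = lB x c * d /\ rB c x * d = c * lB x d
                     /\ rB (c * d) x = c * rB d x) /\
      (forall (k : K) c d, E (k *: c + d) = k *: E c + E d) /\
      E 1 = 1 /\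
      (forall x y c, E (rB (lB x c) y) = x * E c * y).

Inductive gen (a : A) : A -> Prop :=
  | gen_a : gen a a
  | gen_1 : gen a 1
  | gen_add c d : gen a c -> gen a d -> gen a (c + d)
  | gen_scale (k : K) c : gen a c -> gen a (k *: c)
  | gen_mul c d : gen a c -> gen a d -> gen a (c * d)
  | gen_l (x : B) c : gen a c -> gen a (lB x c)
  | gen_r (x : B) c : gen a c -> gen a (rB c x).

Definition bfree (a b : A) : Prop :=
  forall s : seq (A * bool),
    s != [::] ->
    (forall p, p \in s -> E p.1 = 0) ->
    (forall p, p \in s -> if p.2 then gen a p.1 else gen b p.1) ->
    sorted (fun p q : A * bool => p.2 != q.2) s ->
    E (\prod_(p <- s) p.1) = 0.

End Prob.

Inductive ptree := Leaf | Node of ptree & ptree.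

Fixpoint tsize (t : ptree) : nat :=
  match t with Leaf => 0 | Node l r => (tsize l + tsize r).+1 end.

(* Ys n = [:: Y_0; ...; Y_n] *)
Fixpoint Ys (n : nat) : seq (seq ptree) :=
  match n with
  | 0 => [:: [:: Leaf]]
  | n'.+1 =>
      let Y := Ys n' in
      rcons Y (flatten [seq [seq Node s t | s <- nth [::] Y k, t <- nth [::] Y (n' - k)]
                       | k <- iota 0 n'.+1])
  end.

Definition Yn (n : nat) : seq ptree := nth [::] (Ys n) n.

Section Cumulants.
Variables (K : fieldType) (B : algType K) (A : algType K).
Variables (lB : B -> A -> A) (rB : A -> B -> A) (E : A -> B).

(* for tau = tau1 v (tau2 v ( ... v (tauk v |))), the argument list
   [kappa_{tau1}(a_1..a_{j1-1}) a_{j1}; ...; kappa_{tauk}(...) a_{jk}] *)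
Fixpoint kargs (kappa : seq A -> B) (t : ptree) (as_ : seq A) : seq A :=
  match t with
  | Leaf => [::]
  | Node l r =>
      let m := tsize l in
      let inner := match l with Leaf => 1 | _ => kappa (kargs kappa l (take m as_)) end in
      lB inner (nth 0 as_ m) :: kargs kappa r (drop m.+1 as_)
  end.

Definition ktree (kappa : seq A -> B) (t : ptree) (as_ : seq A) : B :=
  if t is Leaf then 1 else kappa (kargs kappa t as_).

Definition cumulant : seq A -> B :=
  epsilon (inhabits (fun _ => 0))
    (fun kappa => forall as_ : seq A, as_ != [::] ->
        E (\prod_(c <- as_) c) = \sum_(t <- Yn (size as_)) ktree kappa t as_).

Definition kfun (a : A) : seq B -> B :=
  fun xs => if xs is [::] then 0 else cumulant (map (fun x => lB x a) xs).

Definition Sa (a : A) : seq B -> B := Stransform (kfun a).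

End Cumulants.

(* Main.v *)
Require Import Defs.
From HB Require Import structures.
From mathcomp Require Import all_boot all_order all_algebra.
From mathcomp Require Import boolp.
From Stdlib Require Import ClassicalEpsilon.
Set Implicit Arguments. Unset Strict Implicit. Unset Printing Implicit Defensive.
Import GRing.Theory.
Local Open Scope ring_scope.

(** Work in the convolution ring of functions [seq B -> A]: with [z := I], the
    moment series [M_c] of [c] satisfies [M_c o g = E ((1 - g c)^-1)] and
    [M_c = 1 + k^c o (M_c z)], so [S_c] is characterised by
    [E ((1 - (1 + z)^-1 z S_c c)^-1) = 1 + z].  Put [w := S_b^-1 z S_b],
    [p := 1 + w], [q := w p^-1], [x := (S_a o w) a] and [y := b S_b].  Then
    [alpha := (1 - q x)^-1] and [beta := (1 - q y)^-1] have expectation [p], while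
    [xi := x alpha - p] and [eta := y beta - p] are centred, and
    [1 - q x y = alpha^-1 (p - q xi p^-1 eta) beta^-1].  Expanding the inverse
    of the middle factor as a geometric series gives alternating centred words,
    which freeness kills; hence [E ((1 - q x y)^-1) = p].  Conjugating by [S_b]
    turns this into the characterisation of the S-transform of [a b]. *)

(** * Sums over cuts and over block decompositions of a list *)

Section Cuts.
Variables (T : Type) (V : nmodType).
Implicit Types (P Q : seq T -> seq T -> V) (s : seq T).

(** Recursion on the list makes the ring laws structural inductions; [csumE] returns to the indexed
    sum used by [mmul]. *)
Fixpoint csum P s : V :=
  if s is x :: s' then P [::] s + csum (fun u v => P (x :: u) v) s'
  else P [::] [::].

Lemma eq_csum P Q s : (forall u v, u ++ v = s -> P u v = Q u v) ->
  csum P s = csum Q s.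
Proof.
elim: s P Q => [|x s IHs] P Q PQ /=; first exact: PQ.
by rewrite PQ //; congr (_ + _); apply: IHs => u v uv; apply: PQ; rewrite /= uv.
Qed.

Lemma csumE P s :
  csum P s = \sum_(0 <= k < (size s).+1) P (take k s) (drop k s).
Proof.
elim: s P => [|x s IHs] P /=; first by rewrite big_nat1.
by rewrite big_nat_recl // take0 drop0 IHs.
Qed.

Lemma csum0 P s : (forall u v, u ++ v = s -> P u v = 0) -> csum P s = 0.
Proof.
move=> P0; rewrite (eq_csum (Q := fun _ _ => 0)) // csumE.
by rewrite big1.
Qed.

Lemma csumD P Q s : csum (fun u v => P u v + Q u v) s = csum P s + csum Q s.
Proof. by rewrite !csumE big_split. Qed.

Lemma csum_rcons P s x :
  csum P (rcons s x) =
  csum (fun u v => P u (rcons v x)) s + P (rcons s x) [::].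
Proof. by elim: s P => [|y s IHs] P //=; rewrite IHs addrA. Qed.

(** Both sides run over the cuts into three pieces; this becomes associativity of the product of
    series. *)
Lemma csumA (G : seq T -> seq T -> seq T -> V) s :
  csum (fun u v => csum (fun u1 u2 => G u1 u2 v) u) s =
  csum (fun u v => csum (fun v1 v2 => G u v1 v2) v) s.
Proof.
elim: s G => [|x s IHs] G //=.
by rewrite csumD IHs !addrA.
Qed.

End Cuts.

Lemma csum_hom (T : Type) (V W : nmodType) (phi : V -> W)
    (P : seq T -> seq T -> V) s :
  (forall x y, phi (x + y) = phi x + phi y) ->
  phi (csum P s) = csum (fun u v => phi (P u v)) s.
Proof. by move=> phiD; elim: s P => [|x s IHs] P //=; rewrite phiD IHs. Qed.

Lemma splits_cons2 (T : Type) (x y : T) s :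
  splits [:: x, y & s] =
  flatten [seq [:: [:: x] :: d ; (x :: head [::] d) :: behead d]
          | d <- splits (y :: s)].
Proof. by []. Qed.

Section Blocks.
Variables (T : Type) (V : nmodType).
Implicit Types (F G : seq (seq T) -> V) (s : seq T).

Definition ssum F s : V := \sum_(d <- splits s) F d.

Lemma ssum_nil F : ssum F [::] = F [::].
Proof. by rewrite /ssum big_seq1. Qed.

(** The first block is [x] followed by a prefix [u] of [s], and the other blocks decompose the
    remaining suffix. Most later inductions use this recursion instead of [splits]. *)
Lemma ssum_cons F x s :
  ssum F (x :: s) = csum (fun u v => ssum (fun d => F ((x :: u) :: d)) v) s.
Proof.
elim: s x F => [|y s IHs] x F; first by rewrite /= ssum_nil /ssum /= big_seq1.
have -> : ssum F [:: x, y & s] =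
    \sum_(d <- splits (y :: s))
      (F ([:: x] :: d) + F ((x :: head [::] d) :: behead d)).
  rewrite /ssum splits_cons2.
  rewrite big_flatten big_map; apply: eq_bigr => d _.
  by rewrite big_cons big_seq1.
rewrite big_split /=; congr (_ + _).
exact: (IHs y (fun d => F ((x :: head [::] d) :: behead d))).
Qed.

Lemma eq_ssum F G s :
  (forall d, flatten d = s -> all (fun u => (0 < size u)%N) d -> F d = G d) ->
  ssum F s = ssum G s.
Proof.
move: {2}(size s) (leqnn (size s)) => n.
elim: n s F G => [|n IHn] [|x s] F G //; try by rewrite !ssum_nil => _ ->.
rewrite /= ltnS => lesn FG; rewrite !ssum_cons; apply: eq_csum => u v uv.
apply: IHn => [|d dv d0]; last by apply: FG => //=; rewrite dv uv.
by apply: leq_trans lesn; rewrite -uv size_cat leq_addl.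
Qed.

Lemma ssumD F G s : ssum (fun d => F d + G d) s = ssum F s + ssum G s.
Proof. exact: big_split. Qed.

(** A cut between blocks amounts to a cut of the list followed by a decomposition of each part. This
    makes composition multiplicative in its outer factor. *)
Lemma ssum_csum (P : seq (seq T) -> seq (seq T) -> V) s :
  ssum (csum P) s =
  csum (fun u v => ssum (fun d => ssum (fun e => P d e) v) u) s.
Proof.
move: {2}(size s) (leqnn (size s)) => n.
elim: n s P => [|n IHn] [|x s] P //; try by rewrite /= !ssum_nil.
rewrite /= ltnS => lesn; rewrite /= !ssum_cons ssum_nil ssum_cons.
rewrite (eq_csum (Q := fun u v => ssum (fun d => P [::] ((x :: u) :: d)) v +
   csum (fun u' v' => ssum (fun d =>
     ssum (fun e => P ((x :: u) :: d) e) v') u') v)); last first.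
  move=> u v uv; rewrite /= ssumD; congr (_ + _).
  apply: (IHn v (fun d => P ((x :: u) :: d))).
  by apply: leq_trans lesn; rewrite -uv size_cat leq_addl.
rewrite csumD; congr (_ + _).
rewrite -csumA; apply: eq_csum => u v _.
by rewrite ssum_cons.
Qed.

End Blocks.

Lemma ssum_hom (T : Type) (V W : nmodType) (phi : V -> W) (F : seq (seq T) -> V) s :
  phi 0 = 0 -> (forall x y, phi (x + y) = phi x + phi y) ->
  phi (ssum F s) = ssum (fun d => phi (F d)) s.
Proof. by move=> phi0 phiD; apply: (big_morph phi phiD phi0). Qed.

Lemma ssum_map (T U : Type) (V : nmodType) (h : T -> U) (F : seq (seq U) -> V) s :
  ssum F (map h s) = ssum (fun d => F (map (map h) d)) s.
Proof.
suff E t : splits (map h t) = map (map (map h)) (splits t).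
  by rewrite /ssum E big_map.
elim: t => [|x [|y t] IHt] //.
rewrite splits_cons2 [map h _]/= splits_cons2 IHt map_flatten -!map_comp.
congr flatten; apply: eq_map => -[|d0 d] //=.
Qed.

(** * Composition through block decompositions *)

Section Comp.
Variables (T U : Type) (V : nmodType).
Definition bcomp (f : seq U -> V) (g : seq T -> U) (s : seq T) : V :=
  ssum (fun d => f (map g d)) s.

Lemma bcomp_nil f g : bcomp f g [::] = f [::].
Proof. by rewrite /bcomp ssum_nil. Qed.

Lemma bcomp_cons f g x s :
  bcomp f g (x :: s) =
  csum (fun u v => bcomp (fun t => f (g (x :: u) :: t)) g v) s.
Proof. exact: ssum_cons. Qed.

(** Blocks are nonempty, so neither their number nor their lengths exceed [size s]. The contraction
    estimates for compositions rest on this. *)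
Lemma eq_bcomp f f' (g g' : seq T -> U) s :
  (forall t, (size t <= size s)%N -> f t = f' t) ->
  (forall u, (size u <= size s)%N -> g u = g' u) ->
  bcomp f g s = bcomp f' g' s.
Proof.
move=> ff' gg'; apply: eq_ssum => d ds d0.
have le_ds : (size d <= size s)%N.
  rewrite -ds; elim: d d0 {ds} => //= u d IHd /andP[u0 /IHd].
  by rewrite size_cat -add1n => /(leq_add u0).
rewrite ff' ?size_map //; congr f'.
have {ds d0 le_ds} : (size (flatten d) <= size s)%N by rewrite ds.
elim: d => //= u d IHd; rewrite size_cat => le_s.
by rewrite gg' ?IHd // (leq_trans _ le_s) ?leq_addr ?leq_addl.
Qed.

End Comp.

(** * The ring of series *)

(** The alias carries the convolution ring structure; multilinearity is not built in and is tracked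
    separately by [mlin]. *)
Definition series (T : Type) (R : pzRingType) : Type := seq T -> R.

Section SeriesRing.
Variables (T : Type) (R : pzRingType).
Implicit Types f g h : series T R.

HB.instance Definition _ := gen_eqMixin (series T R).
HB.instance Definition _ := gen_choiceMixin (series T R).

Definition szero : series T R := fun _ => 0.
Definition sopp f : series T R := fun s => - f s.
Definition sadd f g : series T R := fun s => f s + g s.
Definition sconst (c : R) : series T R := fun s => if s is [::] then c else 0.
Definition smul f g : series T R := csum (fun u v => f u * g v).

Let saddA : associative sadd.
Proof. by move=> f g h; apply/funext => s; rewrite /sadd addrA. Qed.
Let saddC : commutative sadd.
Proof. by move=> f g; apply/funext => s; rewrite /sadd addrC. Qed.
Let sadd0 : left_id szero sadd.
Proof. by move=> f; apply/funext => s; rewrite /sadd add0r. Qed.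
Let saddN : left_inverse szero sopp sadd.
Proof. by move=> f; apply/funext => s; rewrite /sadd addNr. Qed.
HB.instance Definition _ :=
  GRing.isZmodule.Build (series T R) saddA saddC sadd0 saddN.

Let smulA : associative smul.
Proof.
move=> f g h; apply/funext => s; rewrite /smul.
transitivity (csum (fun u v => csum (fun v1 v2 => f u * g v1 * h v2) v) s).
  apply: eq_csum => u v _.
  rewrite (csum_hom (phi := fun x => f u * x)); last by move=> *; rewrite mulrDr.
  by apply: eq_csum => *; rewrite mulrA.
rewrite -csumA; apply: eq_csum => u v _.
by rewrite (csum_hom (phi := fun x => x * h v)) // => *; rewrite mulrDl.
Qed.

Lemma smul_sconstl c f s : smul (sconst c) f s = c * f s.
Proof.
case: s => [|x s]; rewrite /smul //= csum0 ?addr0 // => u v _.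
exact: mul0r.
Qed.

Lemma smul_sconstr c f s : smul f (sconst c) s = f s * c.
Proof.
elim/last_ind: s => [|s x _]; rewrite /smul // csum_rcons csum0 ?add0r // => u v _.
by case: v => [|? ?]; rewrite /= mulr0.
Qed.

Let smul1 : left_id (sconst 1) smul.
Proof. by move=> f; apply/funext => s; rewrite smul_sconstl mul1r. Qed.
Let smulr1 : right_id (sconst 1) smul.
Proof. by move=> f; apply/funext => s; rewrite smul_sconstr mulr1. Qed.
Let smulDl : left_distributive smul sadd.
Proof.
move=> f g h; apply/funext => s; rewrite /smul /sadd -csumD.
by apply: eq_csum => *; rewrite mulrDl.
Qed.
Let smulDr : right_distributive smul sadd.
Proof.
move=> f g h; apply/funext => s; rewrite /smul /sadd -csumD.
by apply: eq_csum => *; rewrite mulrDr.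
Qed.
HB.instance Definition _ :=
  GRing.Zmodule_isPzRing.Build (series T R) smulA smul1 smulr1 smulDl smulDr.

Lemma seriesDE f g s : (f + g) s = f s + g s. Proof. by []. Qed.
Lemma seriesNE f s : (- f) s = - f s. Proof. by []. Qed.
Lemma seriesBE f g s : (f - g) s = f s - g s. Proof. by []. Qed.
Lemma seriesME f g s : (f * g) s = csum (fun u v => f u * g v) s.
Proof. by []. Qed.
Lemma series_nilM f g : (f * g) [::] = f [::] * g [::]. Proof. by []. Qed.

Lemma sconstM c c' : sconst (c * c') = sconst c * sconst c'.
Proof.
by apply/funext => s; rewrite [RHS]smul_sconstl; case: s => //= *; rewrite mulr0.
Qed.

Lemma sconstMl c f s : (sconst c * f) s = c * f s.
Proof. exact: smul_sconstl. Qed.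

Lemma sconstMr c f s : (f * sconst c) s = f s * c.
Proof. exact: smul_sconstr. Qed.

End SeriesRing.

Definition smap (T : Type) (R S : pzRingType) (phi : R -> S) (f : series T R) :
  series T S := fun s => phi (f s).

Section Comp2.
Variables (T U : Type) (R : pzRingType).
Implicit Types (f : series U R) (g : seq T -> U).

Definition scomp f g : series T R := bcomp f g.

Lemma scomp_const c g : scomp (sconst c) g = sconst c.
Proof.
apply/funext => -[|x s]; first exact: bcomp_nil.
by rewrite /scomp bcomp_cons csum0 // => u v _; rewrite /bcomp /ssum big1.
Qed.

Lemma scomp1 g : scomp 1 g = 1.
Proof. exact: scomp_const. Qed.

Lemma scompD f1 f2 g : scomp (f1 + f2) g = scomp f1 g + scomp f2 g.
Proof. by apply/funext => s; apply: ssumD. Qed.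

Lemma scompN f g : scomp (- f) g = - scomp f g.
Proof.
by apply/funext => s; rewrite seriesNE [RHS](ssum_hom (phi := -%R)) ?oppr0 //;
  apply: opprD.
Qed.

(** With [scomp1] and [scompD] this makes right composition a ring morphism, so a series can be
    substituted into any ring identity. *)
Lemma scompM f1 f2 g : scomp (f1 * f2) g = scomp f1 g * scomp f2 g.
Proof.
apply/funext => s; rewrite seriesME /scomp /bcomp.
under eq_ssum => d _ _.
  rewrite seriesME.
  have -> : csum (fun u v => f1 u * f2 v) (map g d) =
    csum (fun u v => f1 (map g u) * f2 (map g v)) d.
    by rewrite !csumE size_map; apply: eq_bigr => k _; rewrite map_take map_drop.
  over.
rewrite (ssum_csum (fun u v => f1 (map g u) * f2 (map g v))).
apply: eq_csum => u v _; rewrite [RHS]mulr_suml.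
by apply: eq_bigr => d _; rewrite [RHS]mulr_sumr.
Qed.

End Comp2.

(** * The variable [z] *)

Section SeriesVariable.
Variable R : pzRingType.

Definition sX : series R R := fun s => if s is [:: x] then x else 0.

Lemma smap_XM (S : pzRingType) (phi : R -> S) (f : series R S) x s :
  phi 0 = 0 -> (smap phi sX * f) (x :: s) = phi x * f s.
Proof.
move=> phi0; rewrite seriesME /= /smap /= phi0 mul0r add0r.
by case: s => [|y s] //=; rewrite csum0 ?addr0 // => u v _; rewrite phi0 mul0r.
Qed.

Lemma smap_MX (S : pzRingType) (phi : R -> S) (f : series R S) x s :
  phi 0 = 0 -> (f * smap phi sX) (rcons s x) = f s * phi x.
Proof.
move=> phi0; rewrite seriesME csum_rcons /= /smap /= phi0 mulr0 addr0.
elim/last_ind: s => [|s y _] //=; rewrite csum_rcons csum0 ?add0r // => u v _.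
by case: v => [|? [|? ?]]; rewrite /= phi0 mulr0.
Qed.

Lemma sXM (f : series R R) x s : (sX * f) (x :: s) = x * f s.
Proof. exact: (smap_XM (phi := id)). Qed.

Lemma sMX (f : series R R) x s : (f * sX) (rcons s x) = f s * x.
Proof. exact: (smap_MX (phi := id)). Qed.

Lemma sXM_nil (f : series R R) : (sX * f) [::] = 0.
Proof. by rewrite series_nilM mul0r. Qed.

Lemma sXM_inj : injective (fun f : series R R => sX * f).
Proof.
move=> f g fg; apply/funext => s.
by move/(congr1 (fun h : series R R => h (1 :: s))): fg; rewrite !sXM !mul1r.
Qed.

(** Only the one-block decomposition survives; on the empty list the composite is 0, whence the
    condition on [g]. *)
Lemma scompX (T : Type) (g : series T R) : g [::] = 0 -> scomp sX g = g.
Proof.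
move=> g0; apply/funext => -[|x s]; first by rewrite [LHS]bcomp_nil.
rewrite /scomp bcomp_cons; elim/last_ind: s => [|s y _]; first exact: bcomp_nil.
rewrite csum_rcons csum0 ?add0r ?bcomp_nil //= => u v _.
case: v => [|z v]; rewrite /= bcomp_cons csum0 // => u' v' _;
  by rewrite /bcomp /ssum big1.
Qed.

End SeriesVariable.
Arguments sX {R}.

Lemma scomp_smap (T U : Type) (R S : pzRingType) (phi : R -> S)
    (f : series U R) (g : seq T -> U) :
  phi 0 = 0 -> (forall x y, phi (x + y) = phi x + phi y) ->
  scomp (smap phi f) g = smap phi (scomp f g).
Proof.
by move=> phi0 phiD; apply/funext => s; rewrite /smap [RHS](ssum_hom _ _ phi0 phiD).
Qed.

(** * Multilinear series *)

Section Mlin.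
Variables (K : fieldType) (U V : lmodType K).
Implicit Types f g : seq U -> V.

(** The predicate [multilinear] between arbitrary modules: it is also applied to maps on lists over
    [A]. *)
Definition mlin f : Prop :=
  forall s1 s2 (k : K) x y,
    f (s1 ++ (k *: x + y) :: s2) = k *: f (s1 ++ x :: s2) + f (s1 ++ y :: s2).

Lemma mlin_cons f y : mlin f -> mlin (fun t => f (y :: t)).
Proof. by move=> fl s1 s2; apply: (fl (y :: s1)). Qed.

Lemma mlin_addl f x y s : mlin f -> f ((x + y) :: s) = f (x :: s) + f (y :: s).
Proof. by move=> fl; have := fl [::] s 1 x y; rewrite !scale1r. Qed.

Lemma mlin_0l f s : mlin f -> f (0 :: s) = 0.
Proof.
by move=> fl; apply: (addrI (f (0 :: s))); rewrite -mlin_addl // !addr0.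
Qed.

Lemma mlin_sum f (I : Type) (r : seq I) (F : I -> U) s : mlin f ->
  f ((\sum_(i <- r) F i) :: s) = \sum_(i <- r) f (F i :: s).
Proof.
move=> fl; apply: (big_morph (fun x => f (x :: s))) => [x y|].
  exact: mlin_addl.
exact: mlin_0l.
Qed.

Lemma mlinD f g : mlin f -> mlin g -> mlin (fun s => f s + g s).
Proof. by move=> fl gl s1 s2 k x y; rewrite fl gl scalerDr addrACA. Qed.

Lemma mlinN f : mlin f -> mlin (fun s => - f s).
Proof. by move=> fl s1 s2 k x y; rewrite fl opprD scalerN. Qed.

End Mlin.

Lemma csum_cat (T : Type) (V : nmodType) (P : seq T -> seq T -> V) s1 z s2 :
  csum P (s1 ++ z :: s2) =
  csum (fun u v => P u (v ++ z :: s2)) s1 + csum (fun u v => P (s1 ++ z :: u) v) s2.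
Proof. by elim: s1 P => [|x s1 IHs] P //=; rewrite IHs addrA. Qed.

Section MlinSums.
Variables (K : fieldType) (V : lmodType K) (T : Type).

Lemma csum_lin k (P Q : seq T -> seq T -> V) s :
  csum (fun u v => k *: P u v + Q u v) s = k *: csum P s + csum Q s.
Proof.
by rewrite csumD (csum_hom (phi := fun x => k *: x)) // => *; rewrite scalerDr.
Qed.

Lemma ssum_lin k (F G : seq (seq T) -> V) s :
  ssum (fun d => k *: F d + G d) s = k *: ssum F s + ssum G s.
Proof.
rewrite ssumD (ssum_hom (phi := fun x => k *: x)) ?scaler0 // => *.
by rewrite scalerDr.
Qed.

End MlinSums.

Section MlinComp.
Variables (K : fieldType) (U V W : lmodType K).

Lemma mlin_csum (P : seq U -> seq U -> V) :
  (forall v, mlin (P^~ v)) -> (forall u, mlin (P u)) -> mlin (csum P).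
Proof.
move=> Pl Pr s1 s2 k x y; rewrite !csum_cat scalerDr addrACA -!csum_lin.
by congr (_ + _); apply: eq_csum => u v _; rewrite ?Pl ?Pr.
Qed.

(** The altered letter lies either in the first block, where [g] and the first argument of [f] are
    linear, or in a later block, which is the induction for [f] with its first argument fixed. *)
Lemma mlin_bcomp (f : seq V -> W) (g : seq U -> V) :
  mlin f -> mlin g -> mlin (bcomp f g).
Proof.
move=> fl gl s1 s2 k x y.
move: {2}(size s1) (leqnn (size s1)) => n.
elim: n s1 f fl => [|n IHn] [|w s1] f fl // le_s.
- rewrite /= !bcomp_cons -csum_lin; apply: eq_csum => u v _.
  rewrite /bcomp -ssum_lin; apply: eq_ssum => d _ _.
  by rewrite (gl [::]) (fl [::]).
- rewrite /= !bcomp_cons -csum_lin; apply: eq_csum => u v _.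
  rewrite /bcomp -ssum_lin; apply: eq_ssum => d _ _.
  by rewrite (gl [::]) (fl [::]).
rewrite /= !bcomp_cons !csum_cat scalerDr addrACA -!csum_lin; congr (_ + _).
  apply: eq_csum => u v uv; apply: (IHn v (fun t => f (g (w :: u) :: t))); first exact: mlin_cons.
  by rewrite -ltnS (leq_trans _ le_s) //= ltnS -uv size_cat leq_addl.
apply: eq_csum => u v _.
rewrite /bcomp -ssum_lin; apply: eq_ssum => d _ _.
by rewrite (gl (w :: s1)) (fl [::]).
Qed.

(** Both sides run over blocks of blocks; linearity of [f] in its first argument takes the inner sum
    [bcomp g h] out of [f]. *)
Lemma bcompA (T S : Type) (f : seq V -> W) (g : seq S -> V) (h : seq T -> S) :
  mlin f -> bcomp f (bcomp g h) = bcomp (bcomp f g) h.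
Proof.
move=> fl; apply/funext => s.
have E t : bcomp (bcomp f g) h t =
    ssum (ssum (fun e => f (map (fun c => g (map h c)) e))) t.
  apply: eq_ssum => d _ _; rewrite /bcomp ssum_map.
  by apply: eq_ssum => e _ _; rewrite -map_comp.
rewrite E {E}.
move: {2}(size s) (leqnn (size s)) => n.
elim: n s f fl => [|n IHn] [|x s] f fl // le_s;
  try by rewrite bcomp_nil !ssum_nil.
rewrite bcomp_cons ssum_cons.
under [RHS]eq_csum => u v _.
  under eq_ssum => d _ _ do rewrite ssum_cons.
  rewrite ssum_csum.
  over.
rewrite -csumA; apply: eq_csum => u v uv.
have le_v : (size v <= n)%N.
  by rewrite -ltnS (leq_trans _ le_s) //= ltnS -uv size_cat leq_addl.
rewrite (IHn v (fun t => f (bcomp g h (x :: u) :: t))) //; last exact: mlin_cons.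
rewrite -[RHS](ssum_cons (fun c => ssum (fun d => ssum (fun e =>
  f (g (map h c) :: map (fun c => g (map h c)) e)) d) v)).
rewrite /ssum exchange_big /=; apply: eq_bigr => d _.
rewrite exchange_big /=; apply: eq_bigr => e _.
by rewrite -mlin_sum.
Qed.

End MlinComp.

Section MlinSeries.
Variables (K : fieldType) (U : lmodType K) (A : algType K).
Implicit Types f g : series U A.

Lemma mlinM f g : mlin f -> mlin g -> mlin (f * g).
Proof.
move=> fl gl; apply: mlin_csum => t s1 s2 k x y.
  by rewrite fl mulrDl scalerAl.
by rewrite gl mulrDr scalerAr.
Qed.

Lemma mlin_sconst (c : A) : mlin (sconst c : series U A).
Proof. by case=> [|? ?] s2 k x y; rewrite /= scaler0 addr0. Qed.

End MlinSeries.

Lemma mlin_sX (K : fieldType) (A : algType K) : mlin (@sX A).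
Proof.
case=> [|? [|? ?]] [|? ?] k x y //=; by rewrite scaler0 addr0.
Qed.

(** A block of length at least two puts 0 into an argument of [f], which multilinearity kills; only
    singletons remain. *)
Lemma bcompX (K : fieldType) (A : algType K) (V : lmodType K) (f : seq A -> V) :
  mlin f -> bcomp f (@sX A) = f.
Proof.
move=> fl; apply/funext => s; elim: s f fl => [|x s IHs] f fl.
  exact: bcomp_nil.
have vanish t : bcomp (fun r => f (0 :: r)) (@sX A) t = 0.
  by rewrite /bcomp /ssum big1 // => d _; rewrite mlin_0l.
rewrite bcomp_cons; case: s IHs => [|y s] IHs; first exact: bcomp_nil.
rewrite /= csum0 => [|u v _]; last exact: vanish.
by rewrite addr0 (IHs (fun r => f (x :: r))) //; apply: mlin_cons.
Qed.

(** * Fixed points of contractions *)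

Section Contractions.
Variables (T V : Type).
Implicit Types (f g : seq T -> V) (Phi : (seq T -> V) -> seq T -> V).

Definition agree n f g := forall s, (size s < n)%N -> f s = g s.

(** Contraction for the ultrametric in which two maps are close when they first differ at a long
    list. *)
Definition contractive Phi :=
  forall n f g, agree n f g -> agree n.+1 (Phi f) (Phi g).

(** The n-th iterate is final below length [n]. The approximation is kept in the conclusion so that
    properties of the iterates pass to the limit. *)
Lemma fixpoint Phi f0 : contractive Phi ->
  exists2 f, Phi f = f & forall n, agree n f (iter n Phi f0).
Proof.
move=> cPhi.
have stab n m : agree n (iter n Phi f0) (iter (n + m) Phi f0).
  by elim: n => [|n IHn] //=; apply: cPhi.
pose f s := iter (size s).+1 Phi f0 s.
have fE n : agree n f (iter n Phi f0).
  by move=> s lt_sn; rewrite /f -(subnKC lt_sn); apply: stab.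
exists f => //; apply/funext => s.
exact: (cPhi (size s) f _ (fE _)).
Qed.

Lemma fixpoint_unique Phi f g :
  contractive Phi -> Phi f = f -> Phi g = g -> f = g.
Proof.
move=> cPhi ff gg; suff fg n : agree n f g.
  by apply/funext => s; apply: (fg (size s).+1).
by elim: n => [|n IHn] //; rewrite -ff -gg; apply: cPhi.
Qed.

End Contractions.

(** Each instance of multilinearity lives in one degree, where [f] equals some [fn n]. *)
Lemma mlin_limit (K : fieldType) (U V : lmodType K) (f : seq U -> V)
    (fn : nat -> seq U -> V) :
  (forall n, agree n f (fn n)) -> (forall n, mlin (fn n)) -> mlin f.
Proof.
move=> ffn fnl s1 s2 k x y; pose n := (size s1 + size s2).+2.
have E z : f (s1 ++ z :: s2) = fn n (s1 ++ z :: s2).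
  by apply: ffn; rewrite size_cat /= addnS.
by rewrite !E fnl.
Qed.

(** * Multiplicative inverses of series *)

Section Inverse.
Variables (K : fieldType) (U : lmodType K) (A : algType K).
Implicit Types f g : series U A.

Lemma agreeM n f f' g g' : agree n f f' -> agree n g g' ->
  agree n (f * g) (f' * g').
Proof.
move=> ff' gg' s lt_s; apply: eq_csum => u v uv.
have := lt_s; rewrite -uv size_cat => lt_uv.
by rewrite ff' ?gg' // (leq_ltn_trans _ lt_uv) ?leq_addr ?leq_addl.
Qed.

(** Without a constant term the right factor takes at least one letter, so the left factor is needed
    only one degree lower. [agreeSM] is the mirror image. *)
Lemma agreeMS n f f' g g' : g [::] = 0 -> g' [::] = 0 ->
  agree n f f' -> agree n.+1 g g' -> agree n.+1 (f * g) (f' * g').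
Proof.
move=> g0 g'0 ff' gg' s; rewrite ltnS => lt_s; apply: eq_csum => u v uv.
have := lt_s; rewrite -uv size_cat => lt_uv.
case: v lt_uv {uv} => [|y v] lt_uv; first by rewrite g0 g'0 !mulr0.
rewrite ff' ?gg' //.
  by rewrite ltnS (leq_trans _ lt_uv) ?leq_addl.
by rewrite (leq_trans _ lt_uv) //= addnS ltnS leq_addr.
Qed.

Lemma agreeSM n f f' g g' : f [::] = 0 -> f' [::] = 0 ->
  agree n.+1 f f' -> agree n g g' -> agree n.+1 (f * g) (f' * g').
Proof.
move=> f0 f'0 ff' gg' s; rewrite ltnS => lt_s; apply: eq_csum => u v uv.
have := lt_s; rewrite -uv size_cat => lt_uv.
case: u lt_uv {uv} => [|y u] lt_uv; first by rewrite f0 f'0 !mul0r.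
rewrite ff' ?gg' //.
  by rewrite (leq_trans _ lt_uv) //= addSn ltnS leq_addl.
by rewrite ltnS (leq_trans _ lt_uv) ?leq_addr.
Qed.

(** A constant [G] yields multiplicative inverses; [G S = scomp F (sX * S)] yields compositional
    ones. *)
Lemma inverse_fixpoint (G : series U A -> series U A) (c c' : A) :
  contractive G -> (forall f, G f [::] = c) ->
  (forall f, mlin f -> mlin (G f)) -> c * c' = 1 -> c' * c = 1 ->
  exists2 f : series U A, mlin f & f [::] = c' /\ f * G f = 1.
Proof.
move=> cG G0 Gl cc' c'c.
(* The equation [f * G f = 1] reads [f c = 1 - f (G f - c)]. Since [G f - c] has no constant term,
   the right side gains a degree. *)
pose Phi (f : series U A) : series U A :=
  (1 - f * (G f - sconst c)) * sconst c'.
have cPhi : contractive Phi.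
  move=> n f g fg; apply: agreeM => // s lt_s; rewrite !seriesBE; congr (_ - _).
  by apply: agreeMS lt_s => //; rewrite ?seriesBE ?G0 ?subrr // => t /(cG _ _ _ fg);
    rewrite !seriesBE => ->.
have [f fE flim] := fixpoint (0 : series U A) cPhi.
exists f.
  apply: mlin_limit flim _; elim=> [|n IHn] /=.
    by move=> *; rewrite scaler0 addr0.
  apply: mlinM; last exact: mlin_sconst.
  apply: mlinD; first exact: mlin_sconst.
  apply/mlinN/mlinM => //; apply: mlinD; first exact: Gl.
  exact/mlinN/mlin_sconst.
split.
  rewrite -fE /Phi series_nilM seriesBE series_nilM seriesBE G0 subrr mulr0.
  by rewrite subr0 mul1r.
have := congr1 (fun g => g * sconst c) fE.
rewrite /= /Phi -mulrA -sconstM c'c mulr1 mulrBr opprB addrCA.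
rewrite -[X in _ = X]addr0 => /addrI/eqP.
by rewrite subr_eq0 => /eqP.
Qed.

(** A left inverse [g] of [f] has a left inverse [h] of its own, which must equal [f]; so [g] is
    two-sided. *)
Lemma mlin_inverse f (c c' : A) : mlin f -> f [::] = c ->
  c * c' = 1 -> c' * c = 1 ->
  exists2 g : series U A, mlin g & [/\ g [::] = c', f * g = 1 & g * f = 1].
Proof.
move=> fl f0 cc' c'c.
have [g gl [g0 gf]] : exists2 g : series U A, mlin g & g [::] = c' /\ g * f = 1.
  exact: (inverse_fixpoint (G := fun=> f) _ _ _ cc' c'c).
have [h hl [h0 hg]] : exists2 h : series U A, mlin h & h [::] = c /\ h * g = 1.
  exact: (inverse_fixpoint (G := fun=> g) _ _ _ c'c cc').
exists g => //; split=> //.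
by rewrite -[f]mul1r -hg -(mulrA h) gf mulr1.
Qed.

End Inverse.

(** * The S-transform *)

Section Stransform.
Variables (K : fieldType) (B : algType K).
Implicit Types f g h F S k : series B B.

Lemma mmulE f g : mmul f g = f * g.
Proof. by apply/funext => s; rewrite seriesME csumE. Qed.

Lemma G_IP f : G_I f -> exists2 F, G_inv F & f = sX * F.
Proof. by case=> F [FG ->]; exists F; rewrite // mmulE. Qed.

Lemma G_I_XM F : G_inv F -> G_I (sX * F).
Proof. by exists F; rewrite mmulE. Qed.

Lemma G_I_mlin f : G_I f -> mlin f.
Proof. by case/G_IP=> F [Fl _] ->; apply: mlinM; first exact: mlin_sX. Qed.

Lemma G_I_nil f : G_I f -> f [::] = 0.
Proof. by case/G_IP=> F _ ->; apply: sXM_nil. Qed.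

(** For [f = z F] and [h = z S] the composite is [z S (F o (z S))], so it suffices to solve
    [S (F o (z S)) = 1]. *)
Lemma G_I_right_inverse f : G_I f -> exists2 h, G_I h & scomp f h = sX.
Proof.
case/G_IP=> F [Fl [c' [cc' c'c]]] ->.
have [S Sl [S0 SF]] : exists2 S : series B B, mlin S &
    S [::] = c' /\ S * scomp F (sX * S) = 1.
  apply: (inverse_fixpoint (G := fun S => scomp F (sX * S)) _ _ _ cc' c'c).
  - move=> n f1 f2 f12 s lt_s; apply: eq_bcomp => // u le_u.
    apply: agreeSM f12 _ _; rewrite ?ltnS //.
    exact: leq_trans le_u _.
  - by move=> f1; apply: bcomp_nil.
  - by move=> f1 f1l; apply: mlin_bcomp => //; apply: mlinM; first exact: mlin_sX.
exists (sX * S).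
  by apply: G_I_XM; split=> //; rewrite S0; exists (F [::]).
by rewrite scompM scompX ?sXM_nil // -mulrA SF mulr1.
Qed.

Lemma scompA f g h : mlin f -> scomp f (scomp g h) = scomp (scomp f g) h.
Proof. exact: bcompA. Qed.

Lemma scomp_idr f : mlin f -> scomp f sX = f.
Proof. exact: bcompX. Qed.

(** If [h'] is a right inverse of [h], then [k = k o (h o h') = h']. Membership of [k] in [G_I] is a
    conclusion; the cumulant series of [a b] gets it this way. *)
Lemma right_inverse_left k h : mlin k -> G_I h -> scomp k h = sX ->
  G_I k /\ scomp h k = sX.
Proof.
move=> kl hG kh; have [h' h'G hh'] := G_I_right_inverse hG.
suff -> : k = h' by [].
rewrite -[k]scomp_idr // -hh' scompA // kh scompX //.
exact: G_I_nil.
Qed.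

Lemma compinvP f : G_I f ->
  [/\ G_I (compinv f), scomp (compinv f) f = sX & scomp f (compinv f) = sX].
Proof.
move=> fG; rewrite /compinv; set P := fun h => _.
have [] : P (epsilon (inhabits (fun _ => 0)) P); last by move=> ? [].
apply: epsilon_spec; have [h hG fh] := G_I_right_inverse fG.
have [_ hf] := right_inverse_left (G_I_mlin fG) hG fh.
by exists h.
Qed.

Lemma StransformP f : G_I f ->
  G_inv (Stransform f) /\ compinv f = sX * Stransform f.
Proof.
move=> fG; rewrite /Stransform -mmulE; set P := fun S => _.
change (P (epsilon (inhabits (fun _ => 0)) P)); apply: epsilon_spec.
by have [/G_IP[S SG SE] _ _] := compinvP fG; exists S; rewrite /P mmulE.
Qed.

Lemma scomp_Stransform f : G_I f -> scomp f (sX * Stransform f) = sX.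
Proof. by move=> fG; have [_ <-] := StransformP fG; have [] := compinvP fG. Qed.

(** The main theorem is reduced through this to a single composition identity. *)
Lemma Stransform_unique f S : mlin f -> G_inv S -> scomp f (sX * S) = sX ->
  Stransform f = S.
Proof.
move=> fl SG fS; have [fG _] := right_inverse_left fl (G_I_XM SG) fS.
have [_ fE] := StransformP fG; have [hG hf _] := compinvP fG.
have hl := G_I_mlin hG; apply: sXM_inj; rewrite -fE.
transitivity (scomp (compinv f) (scomp f (sX * S))).
  by rewrite fS scomp_idr.
by rewrite scompA // hf scompX ?sXM_nil.
Qed.

Lemma G_inv_inverse f : G_inv f ->
  exists2 g : series B B, G_inv g & f * g = 1 /\ g * f = 1.
Proof.
case=> fl [c' [cc' c'c]].
have [g gl [g0 fg gf]] := mlin_inverse fl (erefl _) cc' c'c.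
by exists g => //; split=> //; rewrite g0; exists (f [::]).
Qed.

Lemma minvP f : G_inv f ->
  [/\ mlin (minv f), f * (minv f) = 1 & (minv f : series B B) * f = 1].
Proof.
move=> fG; rewrite -!mmulE /minv; set P := fun g => _.
have [] : P (epsilon (inhabits (fun _ => 0)) P); last by move=> ? [].
apply: epsilon_spec; have [g [gl _] [fg gf]] := G_inv_inverse fG.
by exists g; split=> //; rewrite !mmulE.
Qed.

Lemma G_invM f g : G_inv f -> G_inv g -> G_inv (f * g).
Proof.
move=> [fl [x [fx xf]]] [gl [y [gy yg]]]; split; first exact: mlinM.
exists (y * x); rewrite series_nilM; split.
  by rewrite mulrA -(mulrA (f _)) gy mulr1.
by rewrite mulrA -(mulrA y) xf mulr1.
Qed.

Lemma G_inv_scomp f g : G_inv f -> mlin g -> G_inv (scomp f g).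
Proof. by move=> [fl f0] gl; split; [apply: mlin_bcomp|rewrite [scomp _ _ _]bcomp_nil]. Qed.

End Stransform.

(** * Tree sums *)

Local Notation tsize := Defs.tsize.

Lemma size_Ys n : size (Ys n) = n.+1.
Proof. by elim: n => //= n IHn; rewrite size_rcons IHn. Qed.

Lemma nth_Ys n k : (k <= n)%N -> nth [::] (Ys n) k = Yn k.
Proof.
elim: n => [|n IHn]; first by rewrite leqn0 => /eqP->.
rewrite leq_eqVlt => /predU1P[->//|le_kn].
by rewrite /= nth_rcons size_Ys le_kn IHn.
Qed.

Lemma YnS n :
  Yn n.+1 = flatten [seq [seq Node l r | l <- nth [::] (Ys n) k,
                                         r <- nth [::] (Ys n) (n - k)]
                    | k <- iota 0 n.+1].
Proof. by rewrite {1}/Yn [Ys n.+1]/= nth_rcons size_Ys ltnn eqxx. Qed.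

Section TreeSums.
Variable V : nmodType.
Implicit Types F G : ptree -> V.

Definition tsum F n : V := \sum_(t <- Yn n) F t.

Lemma tsum0 F : tsum F 0 = F Leaf.
Proof. exact: big_seq1. Qed.

Lemma tsumS F n :
  tsum F n.+1 =
  \sum_(0 <= k < n.+1) tsum (fun l => tsum (fun r => F (Node l r)) (n - k)) k.
Proof.
rewrite /tsum YnS big_flatten big_map /index_iota.
rewrite subn0 big_seq [RHS]big_seq; apply: eq_bigr => k.
rewrite mem_iota add0n ltnS => le_kn.
by rewrite big_allpairs_dep !nth_Ys ?leq_subr.
Qed.

Lemma eq_tsum F G n : (forall t, tsize t = n -> F t = G t) -> tsum F n = tsum G n.
Proof.
elim/ltn_ind: n F G => -[|n] IHn F G FG; first by rewrite !tsum0 FG.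
rewrite !tsumS; apply: eq_big_nat => k /andP[_]; rewrite ltnS => le_kn.
apply: (IHn k) => // l lk; apply: (IHn (n - k)%N) => [|r rk]; first by rewrite ltnS leq_subr.
by apply: FG; rewrite /= lk rk subnKC.
Qed.

Lemma tsum_eq0 F n : (forall t, tsize t = n -> F t = 0) -> tsum F n = 0.
Proof. by move=> F0; rewrite (eq_tsum F0) /tsum big1. Qed.

End TreeSums.

(** * Cumulants *)

Section Prob.
Variables (K : fieldType) (B A : algType K).
Variables (lB : B -> A -> A) (rB : A -> B -> A) (E : A -> B).
Hypothesis hA : bprob_space lB rB E.

Lemma lBDl x y c : lB (x + y) c = lB x c + lB y c.
Proof. by move: hA => [-> _]. Qed.
Lemma lBDr x c d : lB x (c + d) = lB x c + lB x d.
Proof. by move: hA => [_ [-> _]]. Qed.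
Lemma lBZl k x c : lB (k *: x) c = k *: lB x c.
Proof. by move: hA => [_ [_ [/(_ k x c)[-> _] _]]]. Qed.
Lemma lBZr k x c : lB x (k *: c) = k *: lB x c.
Proof. by move: hA => [_ [_ [/(_ k x c)[_ ->] _]]]. Qed.
Lemma lB1 c : lB 1 c = c.
Proof. by move: hA => [_ [_ [_ [_ [_ [_ [/(_ c)[]]]]]]]]. Qed.
Lemma lBM x y c : lB (x * y) c = lB x (lB y c).
Proof. by move: hA => [_ [_ [_ [_ [_ [_ [_ [/(_ x y c)[]]]]]]]]]. Qed.
Lemma lB_mul x c d : lB x (c * d) = lB x c * d.
Proof. by move: hA => [_ [_ [_ [_ [_ [_ [_ [_ [/(_ x c d)[]]]]]]]]]]. Qed.
Lemma rB_mid x c d : rB c x * d = c * lB x d.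
Proof. by move: hA => [_ [_ [_ [_ [_ [_ [_ [_ [/(_ x c d)[_ []]]]]]]]]]]. Qed.
Lemma ElinP k c d : E (k *: c + d) = k *: E c + E d.
Proof. by move: hA => [_ [_ [_ [_ [_ [_ [_ [_ [_ [-> _]]]]]]]]]]. Qed.
Lemma E1 : E 1 = 1.
Proof. by move: hA => [_ [_ [_ [_ [_ [_ [_ [_ [_ [_ [-> _]]]]]]]]]]]. Qed.
Lemma E_bimod x y c : E (rB (lB x c) y) = x * E c * y.
Proof. by move: hA => [_ [_ [_ [_ [_ [_ [_ [_ [_ [_ [_ ->]]]]]]]]]]]. Qed.
Lemma rB1 c : rB c 1 = c.
Proof. by move: hA => [_ [_ [_ [_ [_ [_ [/(_ c)[]]]]]]]]. Qed.
Lemma lB0l c : lB 0 c = 0.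
Proof. by have := lBZl 0 0 c; rewrite !scale0r. Qed.
Lemma ED c d : E (c + d) = E c + E d.
Proof. by have := ElinP 1 c d; rewrite !scale1r. Qed.
Lemma E0 : E 0 = 0.
Proof. by apply: (addrI (E 0)); rewrite -ED !addr0. Qed.
Lemma E_lB x c : E (lB x c) = x * E c.
Proof. by rewrite -[lB x c]rB1 E_bimod mulr1. Qed.

Definition moment (s : seq A) : B := E (\prod_(c <- s) c).

(** Grouping the trees of the cumulant formula by the positions [j_i] sums each [kappa_{tau_i}] to a
    moment, so a block [a_1 ... a_m] contributes [E (a_1 ... a_{m-1}) a_m]. The formula becomes
    [bcomp kap last_block = moment]. Empty blocks never occur, so the 0 is a mere default. *)
Definition last_block (s : seq A) : A :=
  if s is x :: s' then lB (moment (belast x s')) (last x s') else 0.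

Lemma last_block_rcons s c : last_block (rcons s c) = lB (moment s) c.
Proof. by case: s => [|x s] //=; rewrite belast_rcons last_rcons. Qed.

Lemma moment_nil : moment [::] = 1.
Proof. by rewrite /moment big_nil E1. Qed.

Lemma last_block1 c : last_block [:: c] = c.
Proof. by rewrite /= moment_nil lB1. Qed.

Lemma mlin_moment : mlin moment.
Proof.
move=> s1 s2 k x y; rewrite /moment !big_cat /= !big_cons.
by rewrite !mulrDl mulrDr -!scalerAl -!scalerAr ElinP.
Qed.

Lemma mlin_last_block : mlin last_block.
Proof.
move=> s1 s2 k x y; case/lastP: s2 => [|s2 c].
  by rewrite !cats1 !last_block_rcons lBDr lBZr.
rewrite -!rcons_cons -!rcons_cat !last_block_rcons mlin_moment.
by rewrite lBDl lBZl.
Qed.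

Definition lhomogeneous (f : seq A -> B) : Prop :=
  forall x c s, f (lB x c :: s) = x * f (c :: s).

Lemma lhomogeneous_moment : lhomogeneous moment.
Proof. by move=> x c s; rewrite /moment !big_cons -lB_mul E_lB. Qed.

Lemma last_block_lB x c s : last_block (lB x c :: s) = lB x (last_block (c :: s)).
Proof.
case/lastP: s => [|s d]; first by rewrite !last_block1.
by rewrite -!rcons_cons !last_block_rcons lhomogeneous_moment lBM.
Qed.

Lemma bcomp_eq0 (f : seq A -> B) (g : seq A -> A) s :
  (forall t, (size t <= size s)%N -> f t = 0) -> bcomp f g s = 0.
Proof.
by move=> f0; rewrite (eq_bcomp (f' := fun=> 0) (g' := g)) // /bcomp /ssum big1.
Qed.

(** Only the decomposition into singletons has enough blocks. Hence composing with [last_block] is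
    unitriangular in the degree. *)
Lemma bcomp_top (f : seq A -> B) s :
  (forall t, (size t < size s)%N -> f t = 0) -> bcomp f last_block s = f s.
Proof.
elim: s f => [|x s IHs] f f0; first exact: bcomp_nil.
rewrite bcomp_cons; case: s IHs f0 => [|y s] IHs f0.
  by rewrite [csum _ _]bcomp_nil last_block1.
rewrite [csum _ _]/= csum0 => [|u v uv]; last first.
  apply: bcomp_eq0 => t le_t; apply: f0.
  by rewrite /= !ltnS (leq_trans le_t) // -uv size_cat leq_addl.
rewrite addr0 (IHs (fun t => f (lB (moment [::]) x :: t))) ?moment_nil ?lB1 //.
by move=> t lt_t; apply: f0.
Qed.

Lemma exists_cumulant : exists kap : seq A -> B,
  [/\ mlin kap, lhomogeneous kap & bcomp kap last_block = moment].
Proof.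
(* A fixed point solves [bcomp f last_block = moment]; by [bcomp_top] the leading terms of a
   difference cancel, so [Phi] is contractive. *)
pose Phi (f : seq A -> B) s := f s + moment s - bcomp f last_block s.
have cPhi : contractive Phi.
  move=> n f g fg s; rewrite ltnS => le_s.
  have fgE : bcomp (fun s => f s - g s) last_block s =
      bcomp f last_block s - bcomp g last_block s.
    by rewrite /bcomp /ssum big_split /= sumrN.
  have := @bcomp_top (fun s => f s - g s) s; rewrite fgE => fg_top.
  rewrite /Phi ![_ + moment s]addrC -!addrA; congr (_ + _).
  rewrite -[f s](subrK (g s)) -fg_top.
    by rewrite addrAC [_ - bcomp g _ _]addrC addrK addrC.
  by move=> t lt_t; rewrite fg ?subrr // (leq_trans lt_t).
have [kap kapE kap_lim] := fixpoint (fun=> 0) cPhi.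
have kmom : bcomp kap last_block = moment.
  apply/funext => s; have := congr1 (fun f => f s) kapE.
  rewrite /Phi -addrA -[RHS]addr0 => /addrI/eqP.
  by rewrite subr_eq0 => /eqP.
exists kap; split=> //.
  apply: mlin_limit kap_lim _; elim=> [|n IHn] /=.
    by move=> *; rewrite scaler0 addr0.
  apply: mlinD; first by apply: mlinD => //; apply: mlin_moment.
  by apply/mlinN/mlin_bcomp => //; apply: mlin_last_block.
have iter_hom n : lhomogeneous (iter n Phi (fun=> 0)).
  elim: n => [|n IHn] x c s /=; first by rewrite mulr0.
  rewrite /Phi IHn lhomogeneous_moment mulrBr mulrDr; congr (_ - _).
  rewrite !bcomp_cons (csum_hom (phi := fun b => x * b)); last first.
    by move=> *; rewrite mulrDr.
  apply: eq_csum => u v _; rewrite last_block_lB /bcomp [RHS]mulr_sumr.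
  by apply: eq_bigr => d _; rewrite IHn.
by move=> x c s; rewrite !(kap_lim (size s).+2) // iter_hom.
Qed.

Lemma size_kargs kap t s : (size (kargs lB kap t s) <= tsize t)%N.
Proof.
elim: t s => [|l _ r IHr] s //=.
by rewrite ltnS (leq_trans (IHr _)) ?leq_addl.
Qed.

Lemma kargs_node kap l r s :
  kargs lB kap (Node l r) s =
  lB (ktree lB kap l (take (tsize l) s)) (nth 0 s (tsize l)) ::
  kargs lB kap r (drop (tsize l).+1 s).
Proof. by case: l. Qed.

(** The tree formula is the block formula: the left subtrees along the right spine sum to the
    moments inside [last_block]. *)
Lemma tsum_ktree (kap : seq A -> B) s :
  mlin kap -> bcomp kap last_block = moment ->
  tsum (fun t => ktree lB kap t s) (size s) = moment s.
Proof.
move=> kl kmom; move: {2 3}(size s) (erefl (size s)) => n sn.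
(* The induction needs both claims: the first, with an argument of [G] fixed, for right subtrees,
   and the second for left subtrees. *)
suff [] : (forall G : seq A -> B, mlin G ->
    tsum (fun t => G (kargs lB kap t s)) n = bcomp G last_block s) /\
  tsum (fun t => ktree lB kap t s) n = moment s by [].
elim/ltn_ind: n s sn => -[|n] IHn [|x s] //= => [_|[sn]].
  by split=> [G _|]; rewrite tsum0 ?bcomp_nil ?moment_nil.
have args (G : seq A -> B) : mlin G ->
    tsum (fun t => G (kargs lB kap t (x :: s))) n.+1 = bcomp G last_block (x :: s).
  move=> Gl; rewrite tsumS bcomp_cons csumE sn.
  apply: eq_big_nat => k /andP[_]; rewrite ltnS => le_kn.
  have size_take_k : size (take k (x :: s)) = k.
    by rewrite size_takel //= sn (leq_trans le_kn).
  have size_drop_k : size (drop k s) = (n - k)%N by rewrite size_drop sn.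
  transitivity (tsum (fun l => bcomp (fun t =>
      G (lB (ktree lB kap l (take k (x :: s))) (nth 0 (x :: s) k) :: t))
      last_block (drop k s)) k).
    apply: eq_tsum => l lk.
    have lt_nk : (n - k < n.+1)%N by rewrite ltnS leq_subr.
    have [IHargs _] := IHn _ lt_nk _ size_drop_k.
    rewrite -(IHargs (fun t => G (_ :: t))); last exact: mlin_cons.
    by apply: eq_tsum => r _; rewrite kargs_node lk.
  have -> : last_block (x :: take k s) =
      lB (moment (take k (x :: s))) (nth 0 (x :: s) k).
    by rewrite -last_block_rcons -take_nth //= sn ltnS.
  have [_ <-] := IHn k le_kn _ size_take_k.
  rewrite /tsum /bcomp /ssum exchange_big /=; apply: eq_bigr => d _.
  rewrite (big_morph (fun b => lB b (nth 0 (x :: s) k)) (id1 := 0) (op1 := +%R)).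
  - by rewrite mlin_sum.
  - by move=> *; rewrite lBDl.
  - exact: lB0l.
split=> //; rewrite -kmom -args //.
by apply: eq_tsum => -[].
Qed.

(** Only the right comb, whose left subtrees are all leaves, yields as many arguments as letters,
    and these are the letters themselves. *)
Lemma tsum_kargs_top (kap f : seq A -> B) s :
  (forall t, (size t < size s)%N -> f t = 0) ->
  tsum (fun t => f (kargs lB kap t s)) (size s) = f s.
Proof.
elim: s f => [|x s IHs] f f0 /=; first by rewrite tsum0.
rewrite tsumS big_nat_recl // tsum0 subn0 /= drop0 lB1.
rewrite (IHs (fun t => f (x :: t))) => [|t lt_t]; last exact: f0.
rewrite big1_seq ?addr0 // => k; rewrite mem_index_iota /= => lt_k.
apply: tsum_eq0 => l _; apply: tsum_eq0 => r rk; apply: f0.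
by rewrite /= ltnS (leq_ltn_trans (size_kargs _ _ _)) // rk subnSK // leq_subr.
Qed.

Lemma eq_kargs (kap kap' : seq A -> B) t s :
  (forall r, (0 < size r < tsize t)%N -> kap r = kap' r) ->
  kargs lB kap t s = kargs lB kap' t s.
Proof.
elim: t s => [|l IHl r IHr] s kk' //; rewrite !kargs_node.
have lt_l : (tsize l < tsize (Node l r))%N by rewrite /= ltnS leq_addr.
have lt_r : (tsize r < tsize (Node l r))%N by rewrite /= ltnS leq_addl.
rewrite IHr => [|q /andP[q0 lt_q]]; last by rewrite kk' // q0 (ltn_trans lt_q).
congr (lB _ _ :: _).
case: l IHl lt_l {kk' lt_r} (kk') => [|l1 l2] // IHl lt_l kk'.
rewrite /ktree IHl => [|q /andP[q0 lt_q]]; last by rewrite kk' // q0 (ltn_trans lt_q).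
by rewrite kk' // (leq_ltn_trans (size_kargs _ _ _)).
Qed.

(** The tree formula determines [cumulant] by induction on length, the comb giving the top term. It
    says nothing about [[::]], whereas [kap [::] = 1]. *)
Lemma cumulantP : exists2 kap : seq A -> B,
  [/\ mlin kap, lhomogeneous kap & bcomp kap last_block = moment] &
  forall s, s != [::] -> cumulant lB E s = kap s.
Proof.
have [kap [kl kh kmom]] := exists_cumulant; exists kap => // s s0.
have : forall s : seq A, s != [::] ->
    E (\prod_(c <- s) c) = \sum_(t <- Yn (size s)) ktree lB (cumulant lB E) t s.
  rewrite /cumulant; set P := fun kappa : seq A -> B => _.
  apply: (epsilon_spec (inhabits (fun=> 0)) P); exists kap => r _.
  exact/esym/tsum_ktree.
move: (cumulant lB E) => kap' kap'E.
move: {2}(size s) (erefl (size s)) => n.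
elim/ltn_ind: n s s0 => n IHn s s0 sn.
(* The value 0 at [[::]] makes [f] vanish on every shorter list; argument lists of nonleaf trees are
   nonempty. *)
pose f r := if r is [::] then 0 else kap' r - kap r.
have ff r : (size r < size s)%N -> f r = 0.
  case: r => [|y r] // lt_r; rewrite /f (IHn (size (y :: r))) ?subrr //.
  by rewrite -sn.
have := tsum_kargs_top kap ff.
have := kap'E s s0; rewrite -[E _]/(moment s) -(tsum_ktree s kl kmom).
rewrite -[\sum_(t <- _) _]/(tsum _ _) => sumE.
have -> : tsum (fun t => f (kargs lB kap t s)) (size s) =
    tsum (fun t => ktree lB kap' t s) (size s) -
    tsum (fun t => ktree lB kap t s) (size s).
  rewrite /tsum -sumrB; apply: eq_tsum => t tn.
  have kk' : kargs lB kap t s = kargs lB kap' t s.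
    apply/esym/eq_kargs => r /andP[r0 lt_r].
    by apply: IHn (erefl _); rewrite -?sn -?tn //; case: r r0 {lt_r}.
  case: t tn kk' => [|l r]; first by case: (s) s0.
  by rewrite /ktree => _ <-; rewrite kargs_node.
rewrite sumE subrr /f; case: (s) s0 => // y r _ /esym/eqP.
by rewrite subr_eq0 => /eqP.
Qed.

(** * Moment and cumulant series of one element *)

Definition mser (c : A) : series B B := fun xs => moment (map (lB^~ c) xs).

Lemma mlin_map (f : seq A -> B) (c : A) :
  mlin f -> mlin (fun xs => f (map (lB^~ c) xs)).
Proof. by move=> fl s1 s2 k x y; rewrite !map_cat /= lBDl lBZl fl. Qed.

(** Homogeneity of [kap] gives [k^c = z F] with [F [::] = E c]. On letters [x_i c], [last_block] of
    a block is the value of [M_c z] times [c], so the block formula becomes the functional equation;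
    the 1 is the constant term of [kap]. *)
Lemma kfunP c :
  [/\ mlin (kfun lB E c), (unitB (E c) -> G_I (kfun lB E c)) &
     mser c = 1 + scomp (kfun lB E c : series B B) (mser c * sX : series B B)].
Proof.
have [kap [kl kh kmom] kapE] := cumulantP.
have kap0 : kap [::] = 1 by rewrite -moment_nil -kmom bcomp_nil.
pose kc : series B B := fun xs => kap (map (lB^~ c) xs).
have kE : kfun lB E c = kc - 1 :> series B B.
  apply/funext => -[|x xs]; first by rewrite seriesBE /kc /= kap0 subrr.
  by rewrite seriesBE /kc /= kapE // subr0.
split.
- rewrite kE; apply: mlinD; first exact: mlin_map.
  exact/mlinN/mlin_sconst.
- move=> Ec; have := @G_I_XM K B (fun xs => kap (c :: map (lB^~ c) xs)).
  set F : series B B := fun xs => _.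
  have -> : sX * F = kfun lB E c :> series B B.
    apply/funext => -[|x xs]; first by rewrite sXM_nil.
    by rewrite sXM kE seriesBE /kc /= kh subr0.
  apply; split; first by apply: (mlin_map (f := fun t => kap (c :: t))); apply: mlin_cons.
  suff -> : F [::] = E c by [].
  have := congr1 (fun f => f [:: c]) kmom.
  by rewrite bcomp_cons [csum _ _]bcomp_nil last_block1 /moment big_seq1.
rewrite kE scompD scompN scomp1 addrC addrNK.
apply/funext => xs.
transitivity (bcomp kap last_block (map (lB^~ c) xs)); first by rewrite kmom.
rewrite /bcomp ssum_map.
apply: eq_ssum => d _ d0; congr kap; rewrite -!map_comp.
elim: d d0 => [|u d IHd] //= /andP[u0 /IHd ->]; congr cons.
case/lastP: u u0 => [|u x] // _.
by rewrite map_rcons last_block_rcons sMX lBM.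
Qed.

End Prob.

(** * Free products of resolvents *)

Section SeriesMaps.
Variables (T : Type) (R S : pzRingType) (phi : R -> S).
Hypothesis phiD : forall x y, phi (x + y) = phi x + phi y.
Implicit Types f g : series T R.

Lemma smapD f g : smap phi (f + g) = smap phi f + smap phi g.
Proof. by apply/funext => s; rewrite /smap !seriesDE phiD. Qed.

Lemma smap0 : smap phi (0 : series T R) = 0.
Proof. by apply: (addrI (smap phi 0)); rewrite -smapD !addr0. Qed.

Lemma smapN f : smap phi (- f) = - smap phi f.
Proof. by apply: (addrI (smap phi f)); rewrite -smapD !subrr smap0. Qed.

Lemma smapB f g : smap phi (f - g) = smap phi f - smap phi g.
Proof. by rewrite smapD smapN. Qed.

Lemma smap_sconst c : smap phi (sconst c : series T R) = sconst (phi c).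
Proof.
apply/funext => -[|x s] //; rewrite /smap /=.
by apply: (addrI (phi 0)); rewrite -phiD !addr0.
Qed.

Lemma smapM f g : (forall x y, phi (x * y) = phi x * phi y) ->
  smap phi (f * g) = smap phi f * smap phi g.
Proof.
move=> phiM; apply/funext => s; rewrite /smap seriesME csum_hom //.
by apply: eq_csum => u v _; rewrite phiM.
Qed.

End SeriesMaps.

(* For a commutative coefficient ring this is Haagerup's factorisation
   1 - (1 + z)/z u v a b = (1 - u a) (...) (1 - v b) of the resolvent of ab. *)
Lemma resolvent_factorisation (R : pzRingType)
    (p p' q x y alpha beta rho : R) :
  p * p' = 1 -> p' * p = 1 -> q * p = p - 1 -> p * q = p - 1 ->
  (1 - q * x) * alpha = 1 -> alpha * (1 - q * x) = 1 ->
  (1 - q * y) * beta = 1 -> beta * (1 - q * y) = 1 ->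
  (1 - q * x * y) * rho = 1 ->
  let xi := x * alpha - p in let eta := y * beta - p in
  let X := p' * q * xi in let Y := p' * eta in
  let Theta := (1 - q * y) * rho in
  Theta = 1 + (X + X * (Y * Theta)) /\ rho = (p + q * eta) * Theta.
Proof.
move=> pp' p'p qp pq xa ax yb by_ xyr xi eta X Y Theta.
(* Indeed [v = 1 + q z v = 1 + q p + q u], and [q p = p - 1]. *)
have shift (u z v : R) : u = z * v - p -> (1 - q * z) * v = 1 -> v = p + q * u.
  move=> ->; rewrite mulrBl mul1r => /eqP; rewrite subr_eq => /eqP {1}->.
  by rewrite mulrBr qp mulrA opprB addrCA [p + _]addrC subrK addrC.
have alphaE : alpha = p + q * xi by apply: shift xa.
have betaE : beta = p + q * eta by apply: shift yb.
have rhoE : rho = beta * Theta by rewrite /Theta mulrA by_ mul1r.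
have qE : q = 1 - p'.
  by rewrite -[q]mulr1 -pp' mulrA qp mulrBl pp' mul1r.
have aqx : alpha * (q * x) = alpha - 1.
  by move: ax; rewrite mulrBr mulr1 => <-; rewrite opprB addrC subrK.
have yE : y * beta = p + eta by rewrite /eta addrC subrK.
(* By [aqx] the left side is [p + eta + alpha (beta - p - eta)], and [q = 1 - p'] turns the bracket
   into [- p' eta]. *)
have core : alpha * (1 - q * x * y) * beta = p - q * xi * (p' * eta).
  rewrite mulrBr mulr1 mulrBl [alpha * (q * x * y)]mulrA aqx -[_ * y * beta]mulrA yE.
  rewrite [(alpha - 1) * _]mulrBl mul1r opprB addrCA -mulrBr.
  have -> : beta - (p + eta) = - (p' * eta).
    by rewrite betaE qE mulrBl mul1r addrA [LHS]addrAC subrr add0r.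
  by rewrite mulrN alphaE mulrDl [p * (p' * eta)]mulrA pp' mul1r opprD addrA addrK.
split; last by rewrite rhoE betaE.
rewrite {}/X {}/Y; clearbody xi eta Theta.
have : p' * (alpha * (1 - q * x * y) * beta * Theta) = p' * alpha.
  by rewrite -(mulrA _ beta) -rhoE -(mulrA alpha) xyr mulr1.
rewrite core alphaE [p' * (_ * Theta)]mulrA mulrBr mulrDr p'p mulrBl mul1r => /eqP.
rewrite subr_eq => /eqP {1}->.
by rewrite addrA !mulrA.
Qed.

(** * Resolvents with coefficients in [A] *)

Section Resolvents.
Variables (K : fieldType) (B A : algType K).
Variables (lB : B -> A -> A) (rB : A -> B -> A) (E : A -> B).
Hypothesis hA : bprob_space lB rB E.

(** Replaces the bimodule actions by products in [A], so that the calculus takes place in the ring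
    of series over [A]. *)
Definition embB x : A := lB x 1.
Local Notation Si := (smap embB).
Local Notation SE := (smap E).

Lemma lBE x c : lB x c = embB x * c.
Proof. by rewrite -(lB_mul hA) mul1r. Qed.
Lemma embBD x y : embB (x + y) = embB x + embB y.
Proof. exact: (lBDl hA). Qed.
Lemma embBM x y : embB (x * y) = embB x * embB y.
Proof. by rewrite -lBE [LHS](lBM hA). Qed.
Lemma embB1 : embB 1 = 1.
Proof. exact: (lB1 hA). Qed.
Lemma embB0 : embB 0 = 0.
Proof. exact: (lB0l hA). Qed.
Lemma E_embBl x c : E (embB x * c) = x * E c.
Proof. by rewrite -lBE (E_lB hA). Qed.
Lemma E_embBr x c : E (c * embB x) = E c * x.
Proof.
by rewrite -(rB_mid hA) mulr1 -[c in LHS](lB1 hA) (E_bimod hA) mul1r.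
Qed.

Implicit Types (f g : series B B) (F G : series B A).

Lemma SiM f g : Si (f * g) = Si f * Si g.
Proof. exact: (smapM embBD _ _ embBM). Qed.
Lemma SiB f g : Si (f - g) = Si f - Si g.
Proof. exact: smapB embBD _ _. Qed.
Lemma Si1 : Si (1 : series B B) = 1.
Proof. by rewrite [LHS](smap_sconst _ embBD) embB1. Qed.
Lemma SED F G : SE (F + G) = SE F + SE G.
Proof. exact: smapD (ED hA) _ _. Qed.
Lemma SEB F G : SE (F - G) = SE F - SE G.
Proof. exact: smapB (ED hA) _ _. Qed.
Lemma SE1 : SE (1 : series B A) = 1.
Proof. by rewrite [LHS](smap_sconst _ (ED hA)) (E1 hA). Qed.
Lemma SEMl f F : SE (Si f * F) = f * SE F.
Proof.
apply/funext => s; rewrite /smap seriesME (csum_hom _ _ (ED hA)).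
by apply: eq_csum => u v _; rewrite E_embBl.
Qed.
Lemma SEMr f F : SE (F * Si f) = SE F * f.
Proof.
apply/funext => s; rewrite /smap seriesME (csum_hom _ _ (ED hA)).
by apply: eq_csum => u v _; rewrite E_embBr.
Qed.
Lemma SEi f : SE (Si f) = f.
Proof. by rewrite -[Si f]mulr1 SEMl SE1 mulr1. Qed.

(** The geometric series [(1 - z c)^-1], with components [x_1 c ... x_n c]. *)
Definition resolvent (c : A) : series B A := fun xs => \prod_(x <- xs) lB x c.

Lemma resolvent_eql c :
  (1 - Si sX * (sconst c : series B A)) * resolvent c = 1.
Proof.
apply/funext => s; rewrite mulrBl mul1r -mulrA seriesBE.
case: s => [|x s]; first by rewrite series_nilM /smap /= embB0 mul0r subr0
  /resolvent big_nil.
by rewrite smap_XM ?embB0 // sconstMl mulrA -lBE /resolvent big_cons subrr.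
Qed.

Lemma resolvent_eqr c :
  resolvent c * (1 - Si sX * (sconst c : series B A)) = 1.
Proof.
apply/funext => s; rewrite mulrBr mulr1 mulrA seriesBE sconstMr.
case/lastP: s => [|s x]; first by rewrite series_nilM /smap /= embB0 mulr0 mul0r subr0
  /resolvent big_nil.
rewrite smap_MX ?embB0 // -mulrA -lBE /resolvent big_rcons subrr.
by case: s.
Qed.

Lemma scomp_resolvent c g : g [::] = 0 ->
  let r := scomp (resolvent c) g in
  (1 - Si g * (sconst c : series B A)) * r = 1 /\
  r * (1 - Si g * (sconst c : series B A)) = 1.
Proof.
move=> g0 r.
have -> : 1 - Si g * (sconst c : series B A) =
    scomp (1 - Si sX * (sconst c : series B A)) g.
  rewrite scompD scompN scompM scomp1 scomp_const.
  by rewrite scomp_smap ?embB0 //; [rewrite scompX|exact: embBD].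
by rewrite -!scompM resolvent_eql resolvent_eqr scomp1.
Qed.

Lemma SE_scomp_resolvent c g :
  SE (scomp (resolvent c) g) = scomp (mser lB E c) g.
Proof.
rewrite -scomp_smap; [|exact: (E0 hA)|exact: (ED hA)].
congr (scomp _ g); apply/funext => s.
by rewrite /smap /resolvent /mser /moment big_map.
Qed.

Lemma scomp_mser c g : g [::] = 0 ->
  scomp (mser lB E c) g =
  1 + scomp (kfun lB E c : series B B) (scomp (mser lB E c) g * g).
Proof.
move=> g0; have [kl _ ME] := kfunP hA c.
by rewrite {1}ME scompD scomp1 -scompA // scompM scompX.
Qed.

(** Both sides are fixed points of [m |-> 1 + k^c o (m g)], contractive because [g] has no constant
    term. *)
Lemma scomp_mser_eq c f g : g [::] = 0 -> (1 + sX) * g = f ->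
  scomp (kfun lB E c : series B B) f = sX -> scomp (mser lB E c) g = 1 + sX.
Proof.
move=> g0 gf kf.
pose Phi m : series B B := 1 + scomp (kfun lB E c : series B B) (m * g).
apply: (@fixpoint_unique _ _ Phi).
- move=> n m m' mm' s lt_s; rewrite /Phi !seriesDE; congr (_ + _).
  apply: eq_bcomp => // u le_u; apply: agreeMS mm' _ _ _ => //.
  exact: leq_trans le_u lt_s.
- by rewrite /Phi -scomp_mser.
- by rewrite /Phi gf kf.
Qed.

Section Gen.
Variable a : A.
Definition gser F := forall s, gen lB rB a (F s).

Lemma gen0 : gen lB rB a 0.
Proof. by rewrite -(scale0r a); apply/gen_scale/gen_a. Qed.

Lemma gser_csum (P : seq B -> seq B -> A) s :
  (forall u v, gen lB rB a (P u v)) -> gen lB rB a (csum P s).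
Proof.
by elim: s P => [|x s IHs] P PG //=; apply: gen_add => //; apply: IHs.
Qed.

Lemma gserM F G : gser F -> gser G -> gser (F * G).
Proof. by move=> FG GG s; apply: gser_csum => u v; apply: gen_mul. Qed.

Lemma gserD F G : gser F -> gser G -> gser (F + G).
Proof. by move=> FG GG s; apply: gen_add. Qed.

Lemma gserB F G : gser F -> gser G -> gser (F - G).
Proof.
move=> FG GG; apply: gserD => // s.
by rewrite seriesNE -scaleN1r; apply: gen_scale.
Qed.

Lemma gser_Si f : gser (Si f).
Proof. by move=> s; apply/gen_l/gen_1. Qed.

Lemma gser_const : gser (sconst a).
Proof. by case=> [|? ?]; [apply: gen_a | apply: gen0]. Qed.

Lemma gser_scomp_resolvent g : gser (scomp (resolvent a) g).
Proof.
move=> s; rewrite /scomp /bcomp /ssum; elim: (splits s) => [|d r IHr].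
  by rewrite big_nil; apply: gen0.
rewrite big_cons; apply: gen_add => //; rewrite /resolvent.
elim: (map g d) => [|x t IHt]; first by rewrite big_nil; apply: gen_1.
by rewrite big_cons; apply: gen_mul => //; apply/gen_l/gen_a.
Qed.

End Gen.

(** * Alternating centred words under freeness *)

Section Free.
Variables (a b : A).
Hypothesis hfree : bfree lB rB E a b.

(** The dummy letter [(0, b0)] gives the empty word a last flag; the first true letter carries the
    flag [~~ b0]. *)
Definition centered_word b0 (l : seq (A * bool)) : Prop :=
  [/\ forall p, p \in l -> E p.1 = 0,
      forall p, p \in l -> if p.2 then gen lB rB a p.1 else gen lB rB b p.1 &
      path (fun p q : A * bool => p.2 != q.2) (0, b0) l].

Lemma centered_word_rcons b0 l c (e : bool) :
  centered_word b0 l -> (last (0, b0) l).2 = ~~ e -> E c = 0 ->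
  (if e then gen lB rB a c else gen lB rB b c) ->
  centered_word b0 (rcons l (c, e)).
Proof.
move=> [lE lG lp] le cE cG; split=> [p|p|].
- by rewrite mem_rcons inE => /predU1P[->//|]; apply: lE.
- by rewrite mem_rcons inE => /predU1P[->//|]; apply: lG.
- by rewrite rcons_path lp le; case: e {le cG}.
Qed.

Lemma E_centered_word b0 l c : centered_word b0 (rcons l c) ->
  E (\prod_(p <- rcons l c) p.1) = 0.
Proof.
move=> [lE lG lp]; apply: hfree => //; first by case: (l).
exact: path_sorted lp.
Qed.

(* Every further turn of the recursion uses up at least one variable, since
   X has no constant term, and appends a letter of each algebra. *)
Lemma free_series_word (X Y Z : series B A) b0 l s :
  gser a X -> gser b Y -> SE X = 0 -> SE Y = 0 -> X [::] = 0 ->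
  Z = X + X * (Y * (1 + Z)) ->
  centered_word b0 l -> (last (0, b0) l).2 = false ->
  E (\prod_(p <- l) p.1 * Z s) = 0.
Proof.
move=> XG YG X0 Y0 Xnil ZE.
have XE u : E (X u) = 0 by rewrite -[LHS]/(SE X u) X0.
have YE u : E (Y u) = 0 by rewrite -[LHS]/(SE Y u) Y0.
move: {2}(size s).+1 (ltnSn (size s)) => n.
elim: n s l => // n IHn s l; rewrite ltnS => le_s lw l0.
have lXw u : centered_word b0 (rcons l (X u, true)).
  by apply: centered_word_rcons => //; rewrite l0.
have EphiD c x y : E (c * (x + y)) = E (c * x) + E (c * y).
  by rewrite mulrDr (ED hA).
rewrite ZE seriesDE EphiD.
have -> : E (\prod_(p <- l) p.1 * X s) = 0.
  by have := E_centered_word (lXw s); rewrite big_rcons.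
rewrite add0r seriesME.
rewrite (csum_hom (phi := fun x => E (\prod_(p <- l) p.1 * x))); last exact: EphiD.
apply: csum0 => u v uv.
case: u uv => [|x u] uv; first by rewrite Xnil mul0r mulr0 (E0 hA).
rewrite mulrA seriesME.
rewrite (csum_hom (phi := fun y => E (\prod_(p <- l) p.1 * X (x :: u) * y))); last exact: EphiD.
apply: csum0 => v1 v2 vv.
have lw' : centered_word b0 (rcons (rcons l (X (x :: u), true)) (Y v1, false)).
  by apply: centered_word_rcons => //; rewrite last_rcons.
have -> : \prod_(p <- l) p.1 * X (x :: u) * (Y v1 * (1 + Z) v2) =
    \prod_(p <- rcons (rcons l (X (x :: u), true)) (Y v1, false)) p.1 * (1 + Z) v2.
  by rewrite !big_rcons !mulrA.
rewrite seriesDE EphiD IHn ?last_rcons ?addr0 //; last first.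
  by rewrite (leq_trans _ le_s) // -uv -vv /= ltnS !size_cat addnA leq_addl.
case: v2 vv => [|? ?] _; last by rewrite mulr0 (E0 hA).
by rewrite mulr1 (E_centered_word lw').
Qed.

(** The first claim starts from the empty word, flagged [false] so that a letter of the algebra of
    [a] may follow; the second starts from the one-letter words [Y' u]. *)
Lemma free_series (X Y Y' Z : series B A) :
  gser a X -> gser b Y -> gser b Y' -> SE X = 0 -> SE Y = 0 -> SE Y' = 0 ->
  X [::] = 0 -> Z = X + X * (Y * (1 + Z)) ->
  SE Z = 0 /\ SE (Y' * Z) = 0.
Proof.
move=> XG YG Y'G X0 Y0 Y'0 Xnil ZE; split; apply/funext => s.
  have := @free_series_word X Y Z false [::] s XG YG X0 Y0 Xnil ZE.
  by rewrite big_nil mul1r; apply.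
rewrite /smap seriesME (csum_hom _ _ (ED hA)); apply: csum0 => u v _.
have := @free_series_word X Y Z true [:: (Y' u, false)] v XG YG X0 Y0 Xnil ZE.
rewrite big_seq1; apply => //.
apply: (@centered_word_rcons true [::] (Y' u) false) => //.
by rewrite -[LHS]/(SE Y' u) Y'0.
Qed.

End Free.
End Resolvents.

Lemma scomp_kfun_free (K : fieldType) (B A : algType K)
    (lB : B -> A -> A) (rB : A -> B -> A) (E : A -> B) (a b : A)
    (Sa Sb Sb' : series B B) :
  bprob_space lB rB E -> bfree lB rB E a b ->
  mlin Sb -> mlin Sb' -> Sb * Sb' = 1 -> Sb' * Sb = 1 ->
  scomp (kfun lB E a : series B B) (sX * Sa) = sX ->
  scomp (kfun lB E b : series B B) (sX * Sb) = sX ->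
  scomp (kfun lB E (a * b) : series B B)
    (sX * (Sb * scomp Sa (Sb' * sX * Sb))) = sX.
Proof.
move=> hA hfree Sbl Sb'l SbSb' Sb'Sb SaE SbE.
have p1l : mlin (1 + sX : series B B).
  by apply: mlinD; [apply: mlin_sconst | apply: mlin_sX].
have [p1' p1'l [_ p1p1' p1'p1]] : exists2 g : series B B, mlin g &
    [/\ g [::] = 1, (1 + sX) * g = 1 & g * (1 + sX) = 1].
  by apply: (mlin_inverse p1l (c := 1)); rewrite ?mulr1 // seriesDE addr0.
set w := Sb' * sX * Sb; set sa := scomp Sa w.
have w0 : w [::] = 0 by rewrite /w !series_nilM mulr0 mul0r.
have wl : mlin w by apply: mlinM; [apply: mlinM => //; apply: mlin_sX |].
have Sbw : Sb * w = sX * Sb by rewrite /w !mulrA SbSb' mul1r.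
pose p : series B B := 1 + w; pose p' := scomp p1' w; pose q := p' * w.
have pE : scomp (1 + sX) w = p by rewrite scompD scomp1 scompX.
have pp' : p * p' = 1 by rewrite -pE -scompM p1p1' scomp1.
have p'p : p' * p = 1 by rewrite -pE -scompM p1'p1 scomp1.
have wE : w = p - 1 by rewrite /p [1 + w]addrC addrK.
have pq : p * q = p - 1 by rewrite /q mulrA pp' mul1r.
have wp : w * p = p * w by rewrite /p mulrDl mulrDr mul1r mulr1.
have qp : q * p = p - 1 by rewrite /q -mulrA wp mulrA p'p mul1r.
have Sbp : Sb * p = (1 + sX) * Sb by rewrite /p mulrDr mulrDl mulr1 mul1r Sbw.
have p'E : Sb' * p1' * Sb = p'.
  rewrite -[LHS]mulr1 -pp' mulrA -[_ * Sb * p]mulrA Sbp.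
  by rewrite -(mulrA Sb') (mulrA p1') p1'p1 mul1r Sb'Sb mul1r.
have q0 : q [::] = 0 by rewrite /q series_nilM w0 mulr0.
have qw : q = p' * w by [].
clearbody q.
(* As [p q = w] and [S_b w = z S_b], this reduces to cancelling [z]. *)
have q_inj f g : q * f = q * g -> f = g.
  move=> /(congr1 (fun h => Sb * (p * h))); rewrite /= !mulrA -(mulrA Sb p q) pq -wE Sbw.
  rewrite -!mulrA => /sXM_inj /(congr1 (fun h => Sb' * h)).
  by rewrite /= !mulrA Sb'Sb !mul1r.
(* The resolvents of [a], [b] and [a b] are taken at [u], [v] and [g]. Here [v = S_b q], so
   conjugation by [S_b] turns [1 - v b] into [1 - q y] and [1 - g a b] into [1 - q x y]. *)
pose u := q * sa; pose v := p1' * sX * Sb; pose g := Sb * u.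
have u0 : u [::] = 0 by rewrite /u series_nilM q0 mul0r.
have v0 : v [::] = 0 by rewrite /v !series_nilM mulr0 mul0r.
have g0 : g [::] = 0 by rewrite /g series_nilM u0 mulr0.
have qE : q = Sb' * v.
  by rewrite qw -p'E -mulrA Sbw /v !mulrA.
(* The characterisation of [S_a], composed on the right with [w]. *)
have Ma : scomp (mser lB E a) u = p.
  have uE : u = scomp (p1' * sX * Sa) w by rewrite /u qw !scompM scompX.
  have Ml : mlin (mser lB E a) by apply: (mlin_map hA); apply: (mlin_moment hA).
  rewrite uE scompA // -pE; congr (scomp _ w).
  apply: (scomp_mser_eq hA _ _ SaE) => //; first by rewrite !series_nilM mulr0 mul0r.
  by rewrite !mulrA p1p1' mul1r.
have Mb : scomp (mser lB E b) v = 1 + sX.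
  by apply: (scomp_mser_eq hA _ _ SbE) => //; rewrite /v !mulrA p1p1' mul1r.
pose Si := smap (embB lB) : series B B -> series B A.
have SiM1 (f h : series B B) : Si (f * h) = Si f * Si h by apply: (SiM hA).
have Si11 : Si 1 = 1 by apply: (Si1 hA).
pose x := Si sa * (sconst a : series B A).
pose y := (sconst b : series B A) * Si Sb.
pose alpha := scomp (resolvent lB a) u.
pose beta0 := scomp (resolvent lB b) v.
pose beta := Si Sb' * beta0 * Si Sb.
pose rho0 := scomp (resolvent lB (a * b)) g.
pose rho := Si Sb' * rho0 * Si Sb.
have [xa ax] : (1 - Si q * x) * alpha = 1 /\ alpha * (1 - Si q * x) = 1.
  by rewrite /x mulrA -SiM1; apply: (scomp_resolvent hA).
have SiSb : Si Sb * Si Sb' = 1 by rewrite -SiM1 SbSb' Si11.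
have SiSb' : Si Sb' * Si Sb = 1 by rewrite -SiM1 Sb'Sb Si11.
have conjM (s t : series B A) :
    (Si Sb' * s * Si Sb) * (Si Sb' * t * Si Sb) = Si Sb' * (s * t) * Si Sb.
  by rewrite -!mulrA (mulrA (Si Sb)) SiSb mul1r !mulrA.
have conjB (s : series B A) : 1 - Si Sb' * s * Si Sb = Si Sb' * (1 - s) * Si Sb.
  by rewrite mulrBr mulr1 mulrBl SiSb'.
have [yb by_] : (1 - Si q * y) * beta = 1 /\ beta * (1 - Si q * y) = 1.
  have -> : Si q * y = Si Sb' * (Si v * (sconst b : series B A)) * Si Sb.
    by rewrite /y qE SiM1 !mulrA.
  have [rl rr] := scomp_resolvent hA b v0.
  by rewrite conjB !conjM rl rr mulr1 SiSb'.
have xyr : (1 - Si q * x * y) * rho = 1.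
  have -> : Si q * x * y =
      Si Sb' * (Si g * (sconst (a * b) : series B A)) * Si Sb.
    rewrite /g SiM1 !mulrA SiSb' mul1r sconstM /x /y /u SiM1 !mulrA.
    by [].
  have [rl _] := scomp_resolvent hA (a * b) g0.
  by rewrite conjB conjM rl mulr1 SiSb'.
have Sipp' : Si p * Si p' = 1 by rewrite -SiM1 pp'.
have Sip'p : Si p' * Si p = 1 by rewrite -SiM1 p'p.
have SiB1 (f h : series B B) : Si (f - h) = Si f - Si h by apply: (SiB hA).
have Siqp : Si q * Si p = Si p - 1 by rewrite -SiM1 qp SiB1 Si11.
have Sipq : Si p * Si q = Si p - 1 by rewrite -SiM1 pq SiB1 Si11.
have [ThetaE rhoE] := resolvent_factorisation
  Sipp' Sip'p Siqp Sipq xa ax yb by_ xyr.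
set xi := x * alpha - Si p in ThetaE; set eta := y * beta - Si p in ThetaE rhoE.
set X := Si p' * Si q * xi in ThetaE; set Y := Si p' * eta in ThetaE.
set Theta := (1 - Si q * y) * rho in ThetaE rhoE.
have SEa : smap E alpha = p by rewrite (SE_scomp_resolvent hA) Ma.
have SEb : smap E beta = p.
  rewrite (SEMr hA) (SEMl hA) (SE_scomp_resolvent hA) Mb -mulrA -Sbp mulrA.
  by rewrite Sb'Sb mul1r.
(* Taking [E] of the resolvent equation gives [q E (z r) = p - 1 = q p], and [q] cancels. *)
have centre (z r : series B A) : (1 - Si q * z) * r = 1 -> smap E r = p ->
    smap E (z * r - Si p) = 0.
  move=> zr rp; rewrite (SEB hA) (SEi hA); apply/eqP; rewrite subr_eq0; apply/eqP.
  apply: q_inj; rewrite -(SEMl hA) mulrA qp -rp.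
  move: zr; rewrite mulrBl mul1r => /(congr1 (smap E)).
  rewrite (SEB hA) (SE1 hA) => <-.
  by rewrite opprB addrC subrK.
have xi0 : smap E xi = 0 by apply: centre xa SEa.
have eta0 : smap E eta = 0 by apply: centre yb SEb.
have xiG : gser lB rB a xi.
  apply: gserB; last exact: gser_Si.
  apply: gserM; last exact: gser_scomp_resolvent.
  by apply: gserM; [apply: gser_Si | apply: gser_const].
have etaG : gser lB rB b eta.
  apply: gserB; last exact: gser_Si.
  apply: gserM; first by apply: gserM; [apply: gser_const | apply: gser_Si].
  apply: gserM; last exact: gser_Si.
  by apply: gserM; [apply: gser_Si | apply: gser_scomp_resolvent].
have XG : gser lB rB a X by apply: gserM => //; rewrite -SiM1; apply: gser_Si.
have YG : gser lB rB b Y by apply: gserM => //; apply: gser_Si.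
have Y'G : gser lB rB b (Si q * eta) by apply: gserM => //; apply: gser_Si.
have X0 : smap E X = 0 by rewrite /X -mulrA !(SEMl hA) xi0 !mulr0.
have Y0 : smap E Y = 0 by rewrite (SEMl hA) eta0 mulr0.
have Y'0 : smap E (Si q * eta) = 0 by rewrite (SEMl hA) eta0 mulr0.
have Xnil : X [::] = 0.
  by rewrite /X !series_nilM /Si /smap q0 (embB0 hA) mulr0 mul0r.
(* [Theta - 1] solves the recursion of [free_series]. *)
have ZE : X + X * (Y * Theta) = X + X * (Y * (1 + (X + X * (Y * Theta)))).
  by rewrite -ThetaE.
have [Z0 Y'Z0] := free_series hA hfree XG YG Y'G X0 Y0 Y'0 Xnil ZE.
have SETheta : smap E Theta = 1 by rewrite ThetaE (SED hA) Z0 (SE1 hA) addr0.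
have SEYTheta : smap E (Si q * eta * Theta) = 0.
  by rewrite ThetaE mulrDr mulr1 (SED hA) Y'0 Y'Z0 addr0.
have SErho : smap E rho = p.
  by rewrite rhoE mulrDl (SED hA) (SEMl hA) SETheta SEYTheta mulr1 addr0.
have Mab : scomp (mser lB E (a * b)) g = 1 + sX.
  rewrite -(SE_scomp_resolvent hA).
  have -> : scomp (resolvent lB (a * b)) g = Si Sb * rho * Si Sb'.
    by rewrite /rho !mulrA SiSb mul1r -mulrA SiSb mulr1.
  by rewrite (SEMr hA) (SEMl hA) SErho Sbp -mulrA SbSb' mulr1.
(* [(1 + z) S_b q = S_b p q = S_b w = z S_b]. The functional equation of [M_{ab}] at [g] then gives
   the claim. *)
have gE : (1 + sX) * g = sX * (Sb * sa).
  by rewrite /g (mulrA _ Sb) -Sbp -(mulrA Sb) /u (mulrA p) pq -wE (mulrA Sb) Sbw mulrA.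
have := scomp_mser hA (a * b) g0; rewrite Mab gE => /addrI kE.
by rewrite [RHS]kE.
Qed.

Theorem theorem4p4 (K : fieldType) (hK : [pchar K] =i pred0)
  (B : algType K) (A : algType K)
  (lB : B -> A -> A) (rB : A -> B -> A) (E : A -> B)
  (hA : bprob_space lB rB E) (a b : A)
  (hfree : bfree lB rB E a b) (ha : unitB (E a)) (hb : unitB (E b)) :
  Sa lB E (a * b) =
  mmul (Sa lB E b)
    (mcomp (Sa lB E a) (mmul (mmul (minv (Sa lB E b)) (@mI K B)) (Sa lB E b))).
Proof.
have [_ /(_ ha) kaG _] := kfunP hA a.
have [_ /(_ hb) kbG _] := kfunP hA b.
have [kabl _ _] := kfunP hA (a * b).
have [SaG _] := StransformP kaG; have [SbG _] := StransformP kbG.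
have [Sb'l SbSb' Sb'Sb] := minvP SbG; have [Sbl _] := SbG.
rewrite !mmulE; apply: Stransform_unique => //.
  apply: G_invM => //; apply: G_inv_scomp => //.
  by apply: mlinM => //; apply: mlinM => //; apply: mlin_sX.
by apply: (scomp_kfun_free hA hfree) => //; apply: scomp_Stransform.
Qed.
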